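(* Let $z\in\mathrm{FPF}_n(\mathcal{I}_n)$. Then $$J^{\mathrm{ss}}_z=\bigcap_{D\in\mathcal{FP}(z)}(u_{ij}:(i,j)\in D)\subseteq\mathbb{K}[\mathrm{Mat}^{\mathrm{ss}}_n].$$
   Context: $\mathbb{K}$ is an algebraically closed field, $n$ a positive integer, $[n]=\{1,\dots,n\}$, $\mathbb{N}=\{1,2,3,\dots\}$. $\mathbb{K}[\mathrm{Mat}^{\mathrm{ss}}_n]=\mathbb{K}[u_{ij}:i,j\in[n],i>j]$ is the coordinate ring of the space of $n\times n$ skew-symmetric matrices, and $(u_{ij}:(i,j)\in D)$ is the ideal in it generated by the indicated variables. (Every $D\in\mathcal{FP}(z)$ as defined below is a subset of $\{(i,j)\in[n]\times[n]:i>j\}$ when $z\in \mathrm{FPF}_n(\mathcal{I}_n)$.) $\mathcal{I}_n=\{w\in S_n:w^2=1\}$. For $y\in\mathcal{I}_n$ with fixed points $i_1<\dots<i_k$ in $[n]$, $\mathrm{FPF}_n(y)$ is the fixed-point-free involution of $\mathbb{N}$ given by $y\cdot(i_1,n+1)(i_2,n+2)\cdots(i_k,n+k)\cdot(n+k+1,n+k+2)(n+k+3,n+k+4)\cdots$. $\mathrm{FPF}_n(\mathcal{I}_n)$ is the image of this map. For a permutation $z$ of $\mathbb{N}$, $\mathrm{rank}\,z_{[i][j]}$ is the number of $a\in[i]$ with $z(a)\in[j]$. For sets $A=\{a_1<\dots<a_q\}$, $B=\{b_1>\dots>b_q\}$ of positive integers let $A\odot B=\{(a_1,b_1),\dots,(a_q,b_q)\}$.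 Define $u^{\mathrm{ss}}_{AB}=0$ if some $(a,b)\in A\odot B$ has $a=b$; otherwise $u^{\mathrm{ss}}_{AB}$ is the product of the variables $u_{ij}$ over the set of distinct pairs $(i,j)$ with $i>j$ such that $(i,j)$ or $(j,i)$ is in $A\odot B$. $J^{\mathrm{ss}}_z$ is the ideal of $\mathbb{K}[u_{ij}:i,j\in[n],i>j]$ generated by all $u^{\mathrm{ss}}_{AB}$ where $A\subseteq[i]$, $B\subseteq[j]$, $|A|=|B|=\mathrm{rank}\,z_{[i][j]}+1$ for some $i,j\in[n]$ with $i\ge j$. Pipe dreams: the reading word of a finite set $D\subset\mathbb{N}\times\mathbb{N}$ lists the numbers $i+j-1$ for $(i,j)\in D$ in the order making $(i,-j)$ increase lexicographically. $\mathcal{RP}(w)$, for a permutation $w$ of $\mathbb{N}$ with finite support, is the set of finite $D\subset\mathbb{N}\times\mathbb{N}$ whose reading word $i_1\cdots i_l$ is a reduced word for $w$ (i.e., $w=s_{i_1}\cdots s_{i_l}$ with $l$ minimal, $s_i=(i,i+1)$). Given $z\in\mathrm{FPF}_n(\mathcal{I}_n)$, choose an even $m$ and a fixed-point-free involution $y\in S_m$ with $z=y\cdot(m+1,m+2)(m+3,m+4)\cdots$; then $\mathcal{FP}(z):=\{D\cap\{(i,j)\in\mathbb{N}\times\mathbb{N}:i>j\}:D=D^T\in\mathcal{RP}(y)\}$, where $D^T$ is the transpose. This does not depend on the choice of $m,y$. *)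

(* Defs.v *)
(* Everything is indexed from 0: the number k of N = {1, 2, ...} is encoded by
   the natural number k - 1, so [i] = {1, ..., i} becomes {a | a < i}, the simple
   transposition s_k = (k, k+1) becomes the swap of k - 1 and k, and a position
   (i, j) of N x N becomes (i - 1, j - 1).  Sizes (n, m, cardinals, and the i, j
   of "rank z_[i][j]") are not shifted. *)
From HB Require Import structures.
From mathcomp Require Import all_boot all_algebra all_fingroup.
From mathcomp Require Import finmap mpoly.
Set Implicit Arguments.
Unset Strict Implicit.
Unset Printing Implicit Defensive.
Import GRing.Theory.

Local Open Scope nat_scope.

(* Permutations of N are functions nat -> nat, compared by =1. *)

Definition ext_perm (n : nat) (y : 'S_n) (a : nat) : nat :=
  if insub a is Some i then val (y i) else a.

(* The product (m+1, m+2)(m+3, m+4)... *)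
Definition swap_tail (m a : nat) : nat :=
  if a < m then a else m + (if odd (a - m) then (a - m).-1 else (a - m).+1).

(* The increasing list i_1 < ... < i_k of the fixed points of y. *)
Definition fixpts (n : nat) (y : 'S_n) : seq nat :=
  [seq val i | i <- enum 'I_n & y i == i].

(* The product (i_1, n+1)...(i_k, n+k), where s lists i_1, ..., i_k < n. *)
Definition link_tail (n : nat) (s : seq nat) (a : nat) : nat :=
  if a \in s then n + index a s
  else if n <= a < n + size s then nth 0 s (a - n) else a.

Definition FPF (n : nat) (y : 'S_n) : nat -> nat :=
  ext_perm y \o link_tail n (fixpts y) \o swap_tail (n + size (fixpts y)).

Definition perm_involution (n : nat) (y : 'S_n) : Prop := (y * y = 1)%g.

Definition FPF_image (n : nat) (z : nat -> nat) : Prop :=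
  exists y : 'S_n, perm_involution y /\ z =1 FPF y.

Definition rank_corner (z : nat -> nat) (i j : nat) : nat :=
  #|[set a : 'I_i | z a < j]|.

Definition adj_swap (k a : nat) : nat :=
  if a == k then k.+1 else if a == k.+1 then k else a.

Definition word_prod (s : seq nat) : nat -> nat :=
  foldr (fun k f => adj_swap k \o f) id s.

Definition reduced_word (w : nat -> nat) (s : seq nat) : Prop :=
  word_prod s =1 w /\ forall t, word_prod t =1 w -> size s <= size t.

(* Lexicographic order on (i, -j). *)
Definition reading_le (p q : nat * nat) : bool :=
  (p.1 < q.1) || (p.1 == q.1) && (q.2 <= p.2).

(* The letter i + j - 1 at position (i, j) is p.1 + p.2 after the shift. *)
Definition reading_word (D : {fset nat * nat}) : seq nat :=
  [seq p.1 + p.2 | p <- sort reading_le (enum_fset D)].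

Definition RP (w : nat -> nat) (D : {fset nat * nat}) : Prop :=
  reduced_word w (reading_word D).

Definition transpose (D : {fset nat * nat}) : {fset nat * nat} :=
  [fset (p.2, p.1) | p in D]%fset.

Definition strict_lower (D : {fset nat * nat}) : {fset nat * nat} :=
  [fset p in D | p.2 < p.1]%fset.

(* The set does not depend on the choice of (m, y); here D ranges over what is
   obtained from any admissible choice. *)
Definition FP (z : nat -> nat) (D : {fset nat * nat}) : Prop :=
  exists (m : nat) (y : 'S_m),
    [/\ ~~ odd m, perm_involution y, (forall i, y i != i),
        z =1 ext_perm y \o swap_tail m
      & exists E : {fset nat * nat},
          [/\ E = transpose E, RP (ext_perm y) E & D = strict_lower E]].

Local Open Scope ring_scope.

Definition ideal_gen (R : comNzRingType) (G : R -> Prop) (f : R) : Prop :=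
  exists (k : nat) (c g : 'I_k -> R),
    (forall l, G (g l)) /\ f = \sum_(l < k) c l * g l.

(* The index set of the variables u_ij, i > j. *)
Definition lower_pair (n : nat) : finType :=
  {p : 'I_n * 'I_n | (p.2 < p.1)%N}.

(* The coordinate ring K[Mat^ss_n]. *)
Definition skew_ring (K : fieldType) (n : nat) : comNzRingType :=
  {mpoly K[#|lower_pair n|]}.

Definition uvar (K : fieldType) (n : nat) (p : lower_pair n) : skew_ring K n :=
  'X_(enum_rank p).

(* [enum] lists a set of ordinals in increasing order. *)
Definition odot (n : nat) (A B : {set 'I_n}) : seq ('I_n * 'I_n) :=
  zip (enum A) (rev (enum B)).

Definition uss (K : fieldType) (n : nat) (A B : {set 'I_n}) : skew_ring K n :=
  if has (fun q => q.1 == q.2) (odot A B) then 0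
  else \prod_(p : lower_pair n | (val p \in odot A B)
                              || (((val p).2, (val p).1) \in odot A B)) uvar K p.

Definition Jss_gen (K : fieldType) (n : nat) (z : nat -> nat)
    (g : skew_ring K n) : Prop :=
  exists (i j : nat) (A B : {set 'I_n}),
    [/\ [/\ (0 < j)%N, (j <= i)%N & (i <= n)%N],
        (forall a, a \in A -> (a < i)%N), (forall b, b \in B -> (b < j)%N),
        #|A| = (rank_corner z i j).+1 /\ #|B| = (rank_corner z i j).+1
      & g = uss K A B].

Definition Jss (K : fieldType) (n : nat) (z : nat -> nat) :
    skew_ring K n -> Prop :=
  ideal_gen (@Jss_gen K n z).

Definition variable_ideal (K : fieldType) (n : nat) (D : {fset nat * nat}) :
    skew_ring K n -> Prop :=
  ideal_gen (fun g => exists p : lower_pair n,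
    (nat_of_ord (val p).1, nat_of_ord (val p).2) \in D /\ g = uvar K p).

(* Main.v *)
(* All ideals are monomial, so it suffices to show two combinatorial facts about
   the support C of a generator or of a monomial of f, closed up under transposition
   in [n] x [n]. Call "chain" a set of positions with increasing rows and decreasing
   columns, i.e. the positions of some A (.) B.

   (1) A chain in [i] x [j] avoiding a pipe dream E of z has at most rank z_[i][j]
   points. Reading E by rows from the bottom, the image of [i] keeps at least
   p + #(points of the chain in rows > p) values among the first p + b ones, where b is
   the column of the highest such point.

   (2) If no chain of C in [i] x [j] is longer than rank z_[i][j], then some D in FP(z)
   misses C. Go through the positions x outside C below the diagonal, from the last
   one in reading order, adding x and its transpose to C. Rerouting the end of a chain
   through x along an antidiagonal shows that only the ranks in row and column
   x.1 + x.2 + 1 of z can become too small; conjugating z by the corresponding simple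
   transposition when it is a descent repairs them. Finally C contains everything
   outside the diagonal, which forces z = (1,2)(3,4)..., so the letters used spell
   a word for z; it is reduced since each conjugation costs two inversions. *)
Require Import Defs.
From mathcomp Require Import all_boot all_algebra all_fingroup.
From mathcomp Require Import finmap mpoly zify.
From Stdlib Require Import Classical.
Set Implicit Arguments.
Unset Strict Implicit.
Unset Printing Implicit Defensive.
Import GRing.Theory.
Local Open Scope nat_scope.

(** * Words and inversions *)

Lemma adj_swapK k : involutive (adj_swap k).
Proof. by move=> a; rewrite /adj_swap; repeat case: eqP => //; lia. Qed.

Lemma ltn_adj_swap k c a : c != k.+1 -> (adj_swap k a < c) = (a < c).
Proof. by rewrite /adj_swap => h; repeat case: eqP => //; lia. Qed.

Lemma adj_swap_id k a : a != k -> a != k.+1 -> adj_swap k a = a.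
Proof. by rewrite /adj_swap => /negbTE -> /negbTE ->. Qed.

Lemma adj_swapL k : adj_swap k k = k.+1.
Proof. by rewrite /adj_swap eqxx. Qed.

Lemma adj_swapR k : adj_swap k k.+1 = k.
Proof. by rewrite /adj_swap eqxx; case: eqP => //; lia. Qed.

Definition far (k l : nat) : bool := (k.+1 < l) || (l.+1 < k).

Lemma adj_swapC k l a : far k l ->
  adj_swap k (adj_swap l a) = adj_swap l (adj_swap k a).
Proof. by rewrite /adj_swap /far => h; repeat (case: eqP => //); lia. Qed.

Lemma word_prod_cat s t a : word_prod (s ++ t) a = word_prod s (word_prod t a).
Proof. by elim: s a => //= k s IH a; rewrite IH. Qed.

Lemma word_prod_rcons s k a :
  word_prod (rcons s k) a = word_prod s (adj_swap k a).
Proof. by rewrite -cats1 word_prod_cat. Qed.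

Lemma word_prod_revK s : cancel (word_prod s) (word_prod (rev s)).
Proof.
elim: s => //= k s IH a.
by rewrite rev_cons word_prod_rcons /= adj_swapK IH.
Qed.

Lemma word_prod_inj s : injective (word_prod s).
Proof. exact: can_inj (@word_prod_revK s). Qed.

Lemma word_prod_id s m a : all (fun k => k.+1 < m) s -> m <= a -> word_prod s a = a.
Proof.
elim: s => //= k s IH /andP[hk hs] ha.
by rewrite (IH hs ha) adj_swap_id //; lia.
Qed.

Lemma word_prod_ltn s m a : all (fun k => k.+1 < m) s -> (word_prod s a < m) = (a < m).
Proof.
elim: s a => //= k s IH a /andP[hk hs].
by rewrite ltn_adj_swap ?IH //; lia.
Qed.

(* [r x y] reads "x may precede y": any two linear extensions of the heap of a
   word have the same product. *)
Lemma word_prod_heap (T : eqType) (r : rel T) (w : T -> nat) (s t : seq T) :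
    (forall x y, r x y -> r y x -> x != y -> far (w x) (w y)) ->
    uniq s -> pairwise r s -> pairwise r t -> perm_eq s t ->
  word_prod (map w s) =1 word_prod (map w t).
Proof.
move=> hr; elim: s t => [|x s IH] t us rs rt st a.
  by move: st; rewrite perm_sym => /perm_nilP ->.
have xt : x \in t by rewrite -(perm_mem st) mem_head.
have ut : uniq t by rewrite -(perm_uniq st).
case/splitPr: xt st rt ut => u v st rt ut.
have {}st : perm_eq s (u ++ v).
  rewrite -(perm_cons x); apply: (perm_trans st).
  by rewrite -cat1s perm_catCA.
move: us rs => /= /andP[xs us] /andP[xr rs].
move: (rt); rewrite pairwise_cat /= => /and3P[ruxv ru /andP[rxv rv]].
move: ruxv; rewrite allrel_consr => /andP[rux ruv].
rewrite (IH (u ++ v)) //; last by rewrite pairwise_cat ruv ru.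
rewrite !map_cat !word_prod_cat /=; move: (word_prod _ a) => b.
(* [x] heads [s] but follows [u] in [t], so [r] holds both ways between [x] and each element of [u];
   hence [x] commutes to the front. *)
have hu : all (fun y => far (w x) (w y)) u.
  apply/allP => y yu.
  have ys : y \in s by rewrite (perm_mem st) mem_cat yu.
  apply: hr; [exact: (allP xr) | exact: (allP rux) |].
  by apply: contraNneq xs => ->.
elim: u hu {st rt ut ru rux ruv} => //= y u IHu /andP[hy hu].
by rewrite adj_swapC // IHu.
Qed.

(** The diagonal position (t, t) has letter 2t, so this is the product contributed by the diagonal
    of a symmetric pipe dream. *)
Lemma word_prod_evens h k a : word_prod [seq t.*2 | t <- iota h k] a =
  if (h.*2 <= a < (h + k).*2) then (if odd a then a.-1 else a.+1) else a.
Proof.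
elim: k h a => [|k IH] h a /=; first by rewrite addn0; case: ifP => //; lia.
rewrite IH /adj_swap.
by do ![case: ifP => //]; lia.
Qed.

Definition inversions (N : nat) (f : nat -> nat) : nat :=
  \sum_(p : 'I_N * 'I_N) ((p.1 < p.2) && (f p.2 < f p.1)).

Lemma eq_inversions N f g : (forall a, a < N -> f a = g a) -> inversions N f = inversions N g.
Proof. by move=> fg; apply: eq_bigr => -[a b] _ /=; rewrite !fg. Qed.

Lemma leq_inversions N M f : N <= M -> inversions N f <= inversions M f.
Proof.
move=> NM; pose F a b : nat := (a < b) && (f b < f a).
rewrite /inversions -(pair_bigA _ (fun a b : 'I_N => F a b)).
rewrite -(pair_bigA _ (fun a b : 'I_M => F a b)) /=.
rewrite (big_ord_widen M (fun a => \sum_(b < N) F a b) NM).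
rewrite big_mkcond; apply: leq_sum => a _; case: ifP => // _.
rewrite (big_ord_widen M (F a) NM).
by rewrite big_mkcond; apply: leq_sum => b _; case: ifP.
Qed.

Lemma inversions_inverse N f g : cancel f g -> cancel g f ->
  (forall a, a < N -> f a < N) -> (forall a, a < N -> g a < N) -> inversions N f = inversions N g.
Proof.
move=> fK gK fN gN.
pose F (a : 'I_N) : 'I_N := Ordinal (fN a (ltn_ord a)).
pose G (a : 'I_N) : 'I_N := Ordinal (gN a (ltn_ord a)).
have FK : cancel F G by move=> a; apply: val_inj => /=; rewrite fK.
have GK : cancel G F by move=> a; apply: val_inj => /=; rewrite gK.
rewrite /inversions (reindex (fun p : 'I_N * 'I_N => (G p.2, G p.1))) /=.
  by apply: eq_bigr => -[a b] _ /=; rewrite !gK andbC.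
by exists (fun p => (F p.2, F p.1)) => -[a b] _; rewrite /= ?FK ?GK.
Qed.

(** Applying the transposition to both entries of a pair matches all inversions except on the pair
    k, k+1, which is split off. Truth values on both sides let one equation cover ascents and
    descents. *)
Lemma inversions_adj_swap N f k : k.+1 < N -> injective f ->
  inversions N (f \o adj_swap k) + (f k.+1 < f k) = inversions N f + (f k < f k.+1).
Proof.
move=> kN finj.
have sN a : a < N -> adj_swap k a < N by move=> aN; rewrite ltn_adj_swap //; lia.
pose S (a : 'I_N) : 'I_N := Ordinal (sN a (ltn_ord a)).
have SK : involutive S by move=> a; apply: val_inj => /=; rewrite adj_swapK.
pose o0 := Ordinal (ltnW kN); pose o1 := Ordinal kN.
rewrite /inversions (reindex (fun p : 'I_N * 'I_N => (S p.1, S p.2))) /=; last first.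
  by exists (fun p => (S p.1, S p.2)) => -[a b] _; rewrite /= !SK.
rewrite (bigD1 (o0, o1)) // (bigD1 (o1, o0)) //=; last first.
  by apply/eqP => -[]; lia.
rewrite [in RHS](bigD1 (o0, o1)) // [in RHS](bigD1 (o1, o0)) //=; last first.
  by apply/eqP => -[]; lia.
rewrite !adj_swapK !adj_swapL !adj_swapR.
under eq_bigr => p _ do rewrite !adj_swapK.
set s1 := \sum_(i | _) _; set s2 := \sum_(i | _) _.
suff -> : s1 = s2 by lia.
apply: eq_bigr => -[a b] /= /andP[].
rewrite !xpair_eqE -!val_eqE /= => h1 h2.
congr (nat_of_bool _).
have [->|] := eqVneq a b; first by rewrite !ltnn.
rewrite -val_eqE /= => hab; congr (_ && _).
rewrite /adj_swap; do ![case: eqP => //]; lia.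
Qed.

Lemma inversions_word_prod N s : all (fun k => k.+1 < N) s -> inversions N (word_prod s) <= size s.
Proof.
elim/last_ind: s => [_|s k IH].
  by rewrite /inversions big1 // => -[a b] _ /=; lia.
rewrite all_rcons size_rcons => /andP[kN hs].
have := inversions_adj_swap kN (@word_prod_inj s).
rewrite (@eq_inversions _ (word_prod (rcons s k)) (word_prod s \o adj_swap k)); last first.
  by move=> a _; rewrite word_prod_rcons.
have := IH hs; lia.
Qed.

(** Strict growth gives a <= f a, and growth over N further steps up to f (a + N) = a + N gives f a
    <= a. *)
Lemma increasing_id N f : (forall k, f k < f k.+1) ->
  (forall a, N <= a -> f a = a) -> f =1 id.
Proof.
move=> inc fN.
have ge a : a <= f a by elim: a => // a; have := inc a; lia.
have le d a : f (a + d) >= f a + d.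
  elim: d => [|d IH]; first by rewrite !addn0.
  by rewrite !addnS; have := inc (a + d); lia.
by move=> a; have := le N a; have := ge a; rewrite [f (a + N)]fN ?leq_addl //=; lia.
Qed.

(** Undoing a descent removes exactly one inversion, and without descents [f] is the identity. With
    [inversions_word_prod] this identifies the inversion number with the length. *)
Lemma word_of_inversions N f : injective f -> (forall a, N <= a -> f a = a) ->
  exists2 s, word_prod s =1 f & size s = inversions N f.
Proof.
move=> finj fN; have [d] := ubnP (inversions N f); elim: d f finj fN => // d IH f finj fN hd.
have neqf a b : a <> b -> f a <> f b by move=> h /finj.
have ltf a : a < N -> f a < N.
  by move=> aN; case: (ltnP (f a) N) => // h; have := fN _ h => /finj; lia.
case: (boolP [forall k : 'I_N, f k < f k.+1]) => [/forallP inc|].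
  have fid : f =1 id.
    apply: (@increasing_id N) => // k; case: (ltnP k N) => kN.
      exact: (inc (Ordinal kN)).
    by rewrite !fN //; lia.
  exists [::] => [a|]; first by rewrite fid.
  by rewrite /inversions big1 // => -[a b] _ /=; rewrite !fid; lia.
rewrite negb_forall => /existsP[[k kN]] /=; rewrite -leqNgt => hk.
have kSN : k.+1 < N.
  rewrite ltn_neqAle kN andbT; apply/eqP => kE.
  by have := ltf _ kN; have := fN k.+1; lia.
have hk' : f k.+1 < f k by have := neqf k k.+1; lia.
have := inversions_adj_swap kSN finj; rewrite hk' ltnNge hk /= => hinv.
have ginj : injective (f \o adj_swap k).
  by apply: inj_comp => //; exact: inv_inj (adj_swapK k).
case: (IH _ ginj) => [a aN|| s sE sS].
- by rewrite /= adj_swap_id ?fN //; lia.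
- lia.
exists (rcons s k) => [a|]; first by rewrite word_prod_rcons sE /= adj_swapK.
by rewrite size_rcons sS; lia.
Qed.

(** The last letter of a reduced word is a descent of [w], and no descent reaches into the range
    that [w] fixes. Dropping this letter leaves a reduced word. *)
Lemma reduced_word_letters m w s : reduced_word w s ->
  (forall a, m <= a -> w a = a) -> all (fun k => k.+1 < m) s.
Proof.
elim/last_ind: s w => // s k IH w [sE smin] wm.
have winj : injective w.
  by move=> a b; rewrite -!sE; exact: word_prod_inj.
(* [inversions] counts inside a window only, so N has to exceed all letters as well as m. *)
have [N [mN kN sN]] : exists N, [/\ m <= N, k.+1 < N & all (fun k => k.+1 < N) s].
  exists (maxn m (maxn k (\max_(l <- s) l)).+2); split; try lia.
  by apply/allP => l ls; have := @leq_bigmax_seq _ s xpredT id l ls isT; rewrite /=; lia.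
have sE' : word_prod s =1 w \o adj_swap k.
  by move=> a; rewrite /= -sE word_prod_rcons adj_swapK.
have desc : w k.+1 < w k.
  have wkk : w k <> w k.+1 by move/winj; lia.
  rewrite ltnNge; apply/negP => asc.
  have [|t tE tS] := @word_of_inversions N w winj; first by move=> a aN; apply: wm; lia.
  have := smin t tE; rewrite tS size_rcons.
  have := inversions_word_prod sN; rewrite (eq_inversions (g := w \o adj_swap k)) //.
  have := inversions_adj_swap kN winj; lia.
(* Otherwise k+1 is fixed; then w k > k+1 is fixed too, and injectivity forces w k = k. *)
have kSm : k.+1 < m.
  rewrite ltnNge; apply/negP => mk.
  have := wm _ mk => wk1; case: (leqP m k) => mk'; first by have := wm _ mk'; lia.
  have wk : w k <> k.+1 by rewrite -wk1 => /winj; lia.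
  have := wm (w k) => h; have : m <= w k by lia.
  by move/h/winj; lia.
rewrite all_rcons kSm; apply: (IH (w \o adj_swap k)) => [|a am]; last first.
  by rewrite /= adj_swap_id ?wm //; lia.
split=> // t tE; have := smin (rcons t k); rewrite !size_rcons ltnS; apply => a.
by rewrite word_prod_rcons tE /= adj_swapK.
Qed.

(** * Rank functions and chains *)

Lemma pairwise_rev (T : Type) (r : rel T) s :
  pairwise r (rev s) = pairwise (fun x y => r y x) s.
Proof.
elim: s => //= x s IH.
rewrite rev_cons -cats1 pairwise_cat allrel1r /= IH andbT all_rev.
by congr (_ && _).
Qed.

(** [rank_corner] as a sum, from which rows can be peeled off one at a time. *)
Definition rk (f : nat -> nat) (i j : nat) : nat := \sum_(a < i) (f a < j).

Lemma rkS f i j : rk f i.+1 j = rk f i j + (f i < j).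
Proof. by rewrite /rk big_ord_recr. Qed.

Lemma rk_cornerE f i j : rank_corner f i j = rk f i j.
Proof. by rewrite /rank_corner /rk -sum1dep_card big_mkcond. Qed.

Lemma eq_rk f g i j : (forall a, a < i -> f a = g a) -> rk f i j = rk g i j.
Proof. by move=> fg; apply: eq_bigr => -[a ai] _; rewrite fg. Qed.

Lemma leq_rkr f i j k : j <= k -> rk f i j <= rk f i k.
Proof. by move=> jk; apply: leq_sum => a _; lia. Qed.

Lemma leq_rkl f i j k : i <= k -> rk f i j <= rk f k j.
Proof.
by move/subnKC <-; elim: (k - i) => [|d IH]; rewrite ?addn0 // addnS rkS; lia.
Qed.

Lemma ltn_sum_eq (x j : nat) : (x < j) = \sum_(b < j) (x == b) :> nat.
Proof.
case: ltnP => xj.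
  rewrite (bigD1 (Ordinal xj)) //= eqxx big1 // => b.
  by rewrite -val_eqE /= eq_sym => /negbTE ->.
by rewrite big1 // => -[b bj] _ /=; lia.
Qed.

Lemma rkC z i j : involutive z -> rk z i j = rk z j i.
Proof.
move=> zK; rewrite /rk.
under eq_bigr do rewrite ltn_sum_eq.
under [RHS]eq_bigr do rewrite ltn_sum_eq.
rewrite exchange_big /=; apply: eq_bigr => b _; apply: eq_bigr => a _.
by congr nat_of_bool; apply/eqP/eqP => [<-|<-]; rewrite zK.
Qed.

(** Passing from i to i+1 adds the truth values of z i < i and z i < i+1, which agree because z i
    differs from i. *)
Lemma rk_diag_even z i : involutive z -> (forall a, z a != a) -> ~~ odd (rk z i i).
Proof.
move=> zK zf; elim: i => [|i IH]; first by rewrite /rk big_ord0.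
rewrite rkS (rkC i) // rkS oddD oddD (negbTE IH); have := zf i; lia.
Qed.

(** The transposition preserves the initial segment [i] unless i cuts between k and k+1. This is why
    only row and column k+1 are ever critical. *)
Lemma rk_adj_swap k f i j : i != k.+1 -> rk (f \o adj_swap k) i j = rk f i j.
Proof.
move=> ik; have sN a : a < i -> adj_swap k a < i by rewrite ltn_adj_swap.
pose S (a : 'I_i) : 'I_i := Ordinal (sN a (ltn_ord a)).
have SK : involutive S by move=> a; apply: val_inj => /=; rewrite adj_swapK.
rewrite /rk (reindex S) /=; last by exists S => a _; rewrite SK.
by apply: eq_bigr => a _; rewrite adj_swapK.
Qed.

Lemma rk_swap_adj k f i j : j != k.+1 -> rk (adj_swap k \o f) i j = rk f i j.
Proof. by move=> jk; apply: eq_bigr => a _; rewrite /= ltn_adj_swap. Qed.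

Local Notation pos := (nat * nat)%type.

Definition tr (x : pos) : pos := (x.2, x.1).

Lemma trK : involutive tr. Proof. by case. Qed.

Definition chain_lt (x y : pos) : bool := (x.1 < y.1) && (y.2 < x.2).

Definition chain (P : pred pos) (i j : nat) (c : seq pos) : bool :=
  pairwise chain_lt c && all (fun x => [&& P x, x.1 < i & x.2 < j]) c.

Implicit Types (P Q : pred pos) (c : seq pos).

Lemma chainP P i j c : reflect
  (pairwise chain_lt c /\ forall x, x \in c -> [/\ P x, x.1 < i & x.2 < j])
  (chain P i j c).
Proof.
apply: (iffP andP) => -[h1 h2]; split=> //.
  by move=> x /(allP h2)/and3P.
by apply/allP => x /h2[-> -> ->].
Qed.

Lemma chain_tr P i j c : (forall x, P (tr x) = P x) ->
  chain P j i (rev (map tr c)) = chain P i j c.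
Proof.
move=> Ptr; rewrite /chain pairwise_rev pairwise_map all_rev all_map; congr (_ && _).
  by apply: eq_pairwise => x y; rewrite /chain_lt /= andbC.
by apply: eq_all => x /=; rewrite Ptr (andbC (x.2 < j)).
Qed.

Lemma sub_chain P Q i j i' j' c : i <= i' -> j <= j' -> (forall x, P x -> Q x) ->
  chain P i j c -> chain Q i' j' c.
Proof.
move=> ii jj PQ /chainP[h1 h2]; apply/chainP; split=> // x /h2[/PQ -> h3 h4].
by split=> //; lia.
Qed.

Lemma subseq_chain P i j c c' : subseq c' c -> chain P i j c -> chain P i j c'.
Proof.
move=> cc /chainP[h1 h2]; apply/chainP; split; first exact: subseq_pairwise cc h1.
by move=> x /(mem_subseq cc)/h2.
Qed.

Lemma chain_size_rows c lo hi : pairwise chain_lt c ->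
  all (fun x => lo <= x.1 < hi) c -> size c <= hi - lo.
Proof.
elim: c lo => //= x c IH lo /andP[/allP h1 h2] /andP[h3 /allP h4].
have : size c <= hi - x.1.+1.
  apply: IH => //; apply/allP => y yc.
  by have /andP[-> _] := h1 y yc; have /andP[_ ->] := h4 y yc.
lia.
Qed.

Lemma chain_size_cols c hi : pairwise chain_lt c ->
  all (fun x => x.2 < hi) c -> size c <= hi.
Proof.
elim: c hi => //= x c IH hi /andP[/allP h1 h2] /andP[h3 _].
suff : size c <= x.2 by lia.
by apply: IH => //; apply/allP => y /h1/andP[].
Qed.

Lemma chain_behead_row P i j c : chain P i.+1 j c ->
  exists2 c', chain P i j c' & size c <= (size c').+1.
Proof.
case/lastP: c => [|c x] /chainP[h1 h2]; first by exists [::].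
exists c; last by rewrite size_rcons.
move: h1; rewrite -cats1 pairwise_cat allrel1r => /and3P[/allP h1 h3 _].
apply/chainP; split=> // y yc.
have [|_ h4 _] := h2 x; first by rewrite mem_rcons mem_head.
have [|Py _ y2] := h2 y; first by rewrite mem_rcons in_cons yc orbT.
by have /andP[y1 _] := h1 y yc; split=> //; exact: leq_trans y1 h4.
Qed.

(** The bound on k keeps the truncated subtraction q - t strictly decreasing in t. *)
Lemma chain_antidiag k p q : k <= q.+1 ->
  pairwise chain_lt [seq (p + t, q - t) | t <- iota 0 k].
Proof.
move=> kq; apply/(pairwiseP (0, 0)) => s t; rewrite !inE size_map size_iota => sk tk st.
rewrite !(nth_map 0) ?size_iota // !nth_iota // /chain_lt /=; lia.
Qed.

Definition read_lt (x y : pos) : bool :=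
  (x.1 < y.1) || (x.1 == y.1) && (y.2 < x.2).

(** The part of the chain from [x] on is replaced by equally many points of an antidiagonal next to
    [x], all later in reading order and hence in [P]. *)
Lemma reroute (P : pred pos) x i j c : x.2 < x.1 ->
    (forall y, y.2 < y.1 -> read_lt x y -> P y) -> i != (x.1 + x.2).+1 ->
    chain (fun y => P y || (y == x)) i j c ->
  exists2 c', chain P i j c' & size c' = size c.
Proof.
move=> xlow Pafter ine /chainP[hc cP].
case: (boolP (x \in c)) => xc; last first.
  exists c => //; apply/chainP; split=> // y yc; have [+ h1 h2] := cP y yc.
  by case/orP => // /eqP yx; rewrite -yx yc in xc.
case/splitPr: xc hc cP => u v.
rewrite pairwise_cat /= => /and3P[/allrelP huv hu /andP[/allP hxv hv]] cP.
have [_ xi xj] : [/\ P x || (x == x), x.1 < i & x.2 < j].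
  by apply: cP; rewrite mem_cat mem_head orbT.
have v1 : size v <= i - x.1.+1.
  apply: chain_size_rows => //; apply/allP => y yv.
  have [|_ h _] := cP y; first by rewrite mem_cat in_cons yv !orbT.
  by have /andP[h1 _] := hxv y yv; apply/andP.
have v2 : size v <= x.2.
  by apply: chain_size_cols => //; apply/allP => y /hxv/andP[].
(* [e = 1] starts the antidiagonal at (x.1 + 1, x.2), [e = 0] at (x.1, x.2 - 1). The first fits when
   i > x.1 + x.2 + 1, the second when i is smaller; at equality neither need fit. *)
pose e : nat := (x.1 + x.2).+1 < i.
have he : e + x.2 >= 1 by rewrite /e; lia.
have hv2 : (size v).+1 <= (x.2 + e - 1).+1 by rewrite /e; lia.
have hv1 : x.1 + e + size v < i by rewrite /e; lia.
have e1 : e <= 1 by rewrite /e; lia.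
clearbody e.
exists (u ++ [seq (x.1 + e + t, (x.2 + e - 1) - t) | t <- iota 0 (size v).+1]); last first.
  by rewrite !size_cat size_map size_iota.
have hu' y : y \in u -> [/\ P y, y.1 < x.1 & x.2 < y.2].
  move=> yu; have /andP[h1 h2] := huv y x yu (mem_head _ _).
  have [|+ _ _] := cP y; first by rewrite mem_cat yu.
  by case/orP => // /eqP yx; move: h1; rewrite yx ltnn.
apply/chainP; split.
  rewrite pairwise_cat hu chain_antidiag ?andbT //; apply/allrelP => y ? yu.
  move=> /mapP[t _ ->]; have [_ h1 h2] := hu' y yu; apply/andP => /=.
  by split; [apply: leq_trans h1 _ | apply: leq_trans h2]; lia.
move=> y; rewrite mem_cat => /orP[yu|].
  have [|_ h1 h2] := cP y; first by rewrite mem_cat yu.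
  by have [] := hu' y yu.
move=> /mapP[t]; rewrite mem_iota => /andP[_ ht] -> /=; split; try lia.
by apply: Pafter; rewrite /read_lt /=; lia.
Qed.

(** The point [x] is rerouted first, with [tr x] kept as allowed; then the transposed chain is
    rerouted, which exchanges i and j and disposes of [tr x]. *)
Lemma reroute_sym (P : pred pos) x i j c : x.2 < x.1 ->
    (forall y, P (tr y) = P y) ->
    (forall y, y.2 < y.1 -> read_lt x y -> P y) ->
    i != (x.1 + x.2).+1 -> j != (x.1 + x.2).+1 ->
    chain (fun y => P y || (y == x) || (y == tr x)) i j c ->
  exists2 c', chain P i j c' & size c' = size c.
Proof.
move=> xlow Ptr Pafter ine jne hc.
have [|||c1 hc1 s1] := @reroute (fun y => P y || (y == tr x)) x i j c xlow => //.
- by move=> y h1 h2; rewrite Pafter.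
- by apply: sub_chain hc => // y; rewrite -!orbA (orbC (y == x)).
pose c2 := rev (map tr c1).
have hc2 : chain (fun y => P y || (y == x)) j i c2.
  rewrite /c2; move: hc1 => /chainP[p1 a1]; apply/chainP; split.
    rewrite pairwise_rev pairwise_map; apply: sub_pairwise p1 => y y'.
    by rewrite /chain_lt /= andbC.
  move=> y; rewrite mem_rev => /mapP[y' /a1[h1 h2 h3] ->]; split=> //.
  by rewrite Ptr (inv_eq trK).
have [c3 hc3 s3] := reroute xlow Pafter jne hc2.
exists (rev (map tr c3)); first by rewrite chain_tr.
by rewrite size_rev size_map s3 size_rev size_map.
Qed.

Lemma pairwise_mem (T : eqType) (r : rel T) s x y : pairwise r s ->
  x \in s -> y \in s -> [|| x == y, r x y | r y x].
Proof.
elim: s => //= z s IH /andP[/allP h1 h2]; rewrite !inE.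
case/orP => [/eqP ->|xs]; case/orP => [/eqP ->|ys]; first by rewrite eqxx.
- by rewrite (h1 _ ys) orbT.
- by rewrite (h1 _ xs) !orbT.
- exact: IH.
Qed.

(** In a chain strictly above the diagonal every row index is smaller than every column index, so
    the reflected chain can be appended. *)
Lemma upper_chain_double P i c : (forall x, P (tr x) = P x) ->
  chain P i i c -> all (fun x => x.1 < x.2) c -> chain P i i (c ++ rev (map tr c)).
Proof.
move=> Ptr hc /allP cu.
have /chainP[h1 h2] := hc; move: (hc); rewrite -(chain_tr _ _ _ Ptr) => /chainP[h3 h4].
apply/chainP; split; last by move=> x; rewrite mem_cat => /orP[/h2|/h4].
rewrite pairwise_cat h1 h3 !andbT; apply/allrelP => x ? xc.
rewrite mem_rev => /mapP[y yc ->].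
have := cu _ xc; have := cu _ yc; have := pairwise_mem h1 xc yc.
by rewrite /chain_lt => /or3P[/eqP ->| |] /=; lia.
Qed.

(* A chain in a symmetric set is reflected from its longer side of the diagonal. *)
Lemma even_chain P i c : (forall x, P (tr x) = P x) -> (forall x, P x -> x.1 != x.2) ->
  chain P i i c -> exists2 c', chain P i i c' & ~~ odd (size c') && (size c <= size c').
Proof.
move=> Ptr Pd hc.
wlog cu : c hc / size c <= (size (filter (fun x => x.1 < x.2) c)).*2.
  move=> H; have [|cl] := leqP (size c) (size (filter (fun x => x.1 < x.2) c)).*2.
    exact: H.
  have [||c' h1 h2] := H (rev (map tr c)); first by rewrite chain_tr.
    rewrite size_rev size_map filter_rev size_rev filter_map size_map.
    move: cl; rewrite !size_filter; set a := preim _ _.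
    have := count_predC a c; suff -> : count (predC a) c = count (fun x => x.1 < x.2) c.
      by lia.
    have /chainP[_ hP] := hc.
    by apply: eq_in_count => x /hP[/Pd h _ _]; rewrite /a /=; lia.
  by exists c' => //; move: h2; rewrite size_rev size_map.
pose u := [seq x <- c | x.1 < x.2].
exists (u ++ rev (map tr u)); last first.
  by rewrite size_cat size_rev size_map addnn odd_double.
apply: upper_chain_double; [exact: Ptr | | exact: filter_all].
exact: subseq_chain (filter_subseq _ _) hc.
Qed.

Lemma chain_behead_col P i j c : chain P i j.+1 c ->
  exists2 c', chain P i j c' & size c <= (size c').+1.
Proof.
case: c => [|x c] /chainP[h1 h2]; first by exists [::].
exists c => //; move: h1 => /= /andP[/allP h1 h3].
have [|_ _ h4] := h2 x; first exact: mem_head.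
apply/chainP; split=> // y yc.
have [|Py y1 _] := h2 y; first by rewrite in_cons yc orbT.
by have /andP[_ y2] := h1 y yc; split=> //; exact: leq_trans y2 h4.
Qed.

Lemma adj_swap_lt k x y : x < y -> (x != k) || (y != k.+1) ->
  adj_swap k x < adj_swap k y.
Proof. by rewrite /adj_swap; do ![case: eqP => //]; lia. Qed.

(** * Un-reading the positions of a pipe dream *)

Definition conj_swap (k : nat) (z : nat -> nat) : nat -> nat :=
  adj_swap k \o z \o adj_swap k.

Record fpf_on (M : nat) (z : nat -> nat) : Prop := FpfOn {
  fpfK : involutive z;
  fpf_neq : forall a, z a != a;
  fpf_ltn : forall a, (z a < M) = (a < M)
}.

Lemma fpf_conj_swap M k z : k.+1 < M -> fpf_on M z -> fpf_on M (conj_swap k z).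
Proof.
move=> kM [zK zf zM]; split=> [a|a|a]; rewrite /conj_swap /=.
- by rewrite adj_swapK zK adj_swapK.
- by rewrite (inv_eq (@adj_swapK k)) zf.
- by rewrite !ltn_adj_swap ?zM ?ltn_adj_swap //; lia.
Qed.

Definition bounded (M : nat) (z : nat -> nat) P : Prop :=
  forall i j c, i <= M -> j <= M -> chain P i j c -> size c <= rk z i j.

Definition add_pos P (x : pos) : pred pos := fun y => P y || (y == x) || (y == tr x).

Lemma add_pos_tr P x : (forall y, P (tr y) = P y) ->
  forall y, add_pos P x (tr y) = add_pos P x y.
Proof.
move=> Ptr y; rewrite /add_pos Ptr (inv_eq trK) (inj_eq (can_inj trK)).
by rewrite -!orbA (orbC (y == tr x)).
Qed.

(** If z k < j, the rank grows by one from row bound k to k+1, as much as a chain can grow. If not,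
    then z k.+1 >= j as well, and the rank at k+1 already equals that at k+2. *)
Lemma rk_asc_bound P z k j : z k < z k.+1 ->
  (forall c, chain P k j c -> size c <= rk z k j) ->
  (forall c, chain P k.+2 j c -> size c <= rk z k.+2 j) ->
  (forall c, chain P k.+1 j c -> size c <= rk z k.+1 j).
Proof.
move=> asc h0 h2 c hc.
have s2 := h2 c (sub_chain (leqnSn _) (leqnn _) (fun _ => id) hc).
have [c' /h0 s0 s1] := chain_behead_row hc.
move: s2; rewrite !rkS; lia.
Qed.

(** Row k+1 follows from [rk_asc_bound], column k+1 by transposition, and the corner (k+1, k+1) from
    the rest of column k+1. *)
Lemma bounded_asc M z P k : involutive z -> (forall y, P (tr y) = P y) ->
    k.+1 < M -> z k < z k.+1 ->
    (forall i j c, i <= M -> j <= M -> i != k.+1 -> j != k.+1 ->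
       chain P i j c -> size c <= rk z i j) ->
  bounded M z P.
Proof.
move=> zK Ptr kM asc H.
have Hr j : j <= M -> j != k.+1 ->
    forall c, chain P k.+1 j c -> size c <= rk z k.+1 j.
  by move=> jM jk; apply: rk_asc_bound => // c; apply: H => //; lia.
have Hc i : i <= M -> i != k.+1 ->
    forall c, chain P i k.+1 c -> size c <= rk z i k.+1.
  move=> iM ik c; rewrite -(chain_tr _ _ _ Ptr) => /Hr.
  by rewrite size_rev size_map (rkC _ _ zK); apply.
move=> i j; have [->|ik] := eqVneq i k.+1; have [->|jk] := eqVneq j k.+1.
- move=> c _ _; apply: rk_asc_bound => // {}c; apply: Hc => //; lia.
- by move=> c _ jM; exact: Hr.
- by move=> c iM _; exact: Hc.
- by move=> c iM jM; exact: H.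
Qed.

Lemma rk_fpf_full M z j : fpf_on M z -> j <= M -> rk z M j = j.
Proof.
move=> [zK _ zM] jM; rewrite rkC // /rk.
rewrite (eq_bigr (fun=> 1)); first by rewrite sum1_card card_ord.
by case=> b bj _ /=; rewrite zM (leq_trans bj jM).
Qed.

Lemma chain_leq P i j c : chain P i j c -> size c <= j.
Proof.
case/chainP=> h1 h2; apply: chain_size_cols => //.
by apply/allP => x /h2[].
Qed.

Section Step.
Variables (M : nat) (z : nat -> nat) (P : pred pos) (x : pos).
Hypotheses (zP : fpf_on M z) (Ptr : forall y, P (tr y) = P y).
Hypotheses (Pd : forall y, P y -> y.1 != y.2) (xlow : x.2 < x.1).
Hypothesis Pafter : forall y, y.2 < y.1 -> read_lt x y -> P y.
Hypothesis zb : bounded M z P.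
Let k := x.1 + x.2.
Let zK : involutive z := fpfK zP.

Lemma bounded_away i j c : i <= M -> j <= M -> i != k.+1 -> j != k.+1 ->
  chain (add_pos P x) i j c -> size c <= rk z i j.
Proof.
move=> iM jM ik jk hc.
by have [c' hc' <-] := reroute_sym xlow Ptr Pafter ik jk hc; exact: zb.
Qed.

(** A corner in row or column k+1 can then only be in row or column M, where the rank is as large as
    any chain. *)
Lemma bounded_high : M <= k.+1 -> bounded M z (add_pos P x).
Proof.
move=> Mk i j c iM jM hc.
have [iE|ik] := eqVneq i k.+1.
  have -> : i = M by lia.
  by rewrite (rk_fpf_full zP) //; exact: chain_leq hc.
have [jE|jk] := eqVneq j k.+1; last exact: bounded_away.
have jE' : j = M by lia.
move: hc; rewrite rkC // jE' (rk_fpf_full zP) // -(chain_tr _ _ _ (add_pos_tr x Ptr)).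
by move/chain_leq; rewrite size_rev size_map.
Qed.

Lemma bounded_ascent : k.+1 < M -> z k < z k.+1 -> bounded M z (add_pos P x).
Proof.
move=> kM asc; apply: (bounded_asc (k := k)) => //; first exact: add_pos_tr.
exact: bounded_away.
Qed.

Lemma conj_descent : z k.+1 < z k -> z k != k.+1 -> conj_swap k z k < conj_swap k z k.+1.
Proof.
move=> desc zk; rewrite /conj_swap /= adj_swapL adj_swapR.
by apply: adj_swap_lt => //; rewrite zk orbT.
Qed.

(** Conjugation keeps all ranks away from row and column k+1 and turns the descent into an ascent,
    so [bounded_asc] applies. *)
Lemma bounded_descent : k.+1 < M -> z k.+1 < z k -> z k != k.+1 ->
  bounded M (conj_swap k z) (add_pos P x).
Proof.
move=> kM desc zk; apply: (bounded_asc (k := k)) => //.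
- by case: (fpf_conj_swap kM zP).
- exact: add_pos_tr.
- exact: conj_descent.
by move=> i j c iM jM ik jk; rewrite /conj_swap rk_adj_swap // rk_swap_adj //; exact: bounded_away.
Qed.

(* At the corner (k+1, k+1) the bound follows from parity: both the rank of an
   fpf involution and the longest chain of a symmetric set are even there. *)
Lemma bounded_link : k.+1 < M -> z k = k.+1 -> bounded M z (add_pos P x).
Proof.
move=> kM zk; have zk1 : z k.+1 = k by rewrite -zk zK.
pose P' := add_pos P x; have P'tr := add_pos_tr x Ptr.
(* For j other than k+1 the values k and k+1 lie on the same side of j, so the argument for an
   ascent still works. *)
have Hr j : j <= M -> j != k.+1 ->
    forall c, chain P' k.+1 j c -> size c <= rk z k.+1 j.
  move=> jM jk c hc.
  have s2 : size c <= rk z k.+2 j.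
    apply: bounded_away (sub_chain (leqnSn _) (leqnn _) (fun _ => id) hc) => //; lia.
  have [c' hc' s1] := chain_behead_row hc.
  have s0 : size c' <= rk z k j by apply: bounded_away hc' => //; lia.
  move: s2; rewrite !rkS zk zk1; lia.
move=> i j; have [->|ik] := eqVneq i k.+1; have [->|jk] := eqVneq j k.+1.
- move=> c _ _ hc.
  have [|c' hc' /andP[ev sc]] := even_chain P'tr _ hc.
    by move=> y /orP[/orP[/Pd //|/eqP ->]|/eqP ->] /=; lia.
  (* Dropping a column bounds [c'] by one more than the rank at (k+2, k). That rank equals the even
     ranks at (k, k) and (k+1, k+1), so parity removes the extra one. *)
  have [c'' hc'' s1] := chain_behead_col hc'.
  have s2 : size c'' <= rk z k.+2 k.
    apply: bounded_away (sub_chain (leqnSn _) (leqnn _) (fun _ => id) hc'') => //; lia.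
  have := rk_diag_even k zK (fpf_neq zP).
  rewrite rkS (rkC _ _ zK) rkS zk; move: s2; rewrite !rkS zk zk1; lia.
- by move=> c _ jM; exact: Hr.
- move=> c iM _; rewrite -(chain_tr _ _ _ P'tr) => /Hr.
  by rewrite size_rev size_map (rkC _ _ zK); apply.
- by move=> c iM jM; exact: bounded_away.
Qed.

End Step.

(** The involution (1,2)(3,4)... in the shifted indexing. *)
Definition flip (a : nat) : nat := if odd a then a.-1 else a.+1.

Lemma rk_full f i j : i <= rk f i j -> forall a, a < i -> f a < j.
Proof.
elim: i => // i IH; rewrite rkS => h a.
have le : rk f i j <= i.
  rewrite /rk -[X in _ <= X](card_ord i) -sum1_card; apply: leq_sum => b _.
  exact: leq_b1.
rewrite ltnS leq_eqVlt => /orP[/eqP ->|]; first by move: h; lia.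
by apply: IH; lia.
Qed.

(** The antidiagonal of the square of even side 2t avoids the diagonal and is a chain of length 2t,
    so [z] maps [2t] into itself for every t. The blocks of size two between these segments are then
    swapped. *)
Lemma bounded_offdiag M z : ~~ odd M -> fpf_on M z ->
  bounded M z (fun y => y.1 != y.2) -> forall a, a < M -> z a = flip a.
Proof.
move=> Mev [zK zf zM] zb.
have full t : t.*2 <= M -> forall a, a < t.*2 -> z a < t.*2.
  move=> tM; apply: rk_full.
  have := zb t.*2 t.*2 [seq (0 + s, t.*2.-1 - s) | s <- iota 0 t.*2] tM tM.
  rewrite size_map size_iota; apply; apply/chainP; split.
    by apply: chain_antidiag; lia.
  by move=> y /mapP[s]; rewrite mem_iota => hs -> /=; split; lia.
move=> a aM.
have := zf a; have := full a./2; have := full a./2.+1.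
rewrite /flip => h1 h2 za.
have {}h1 : z a < a./2.+1.*2 by apply: h1; lia.
case: (ltnP (z a) a./2.*2) => h3; last by case: ifP; lia.
have := h2 _ _ h3; rewrite zK; lia.
Qed.

Definition letter (x : pos) : nat := x.1 + x.2.

Definition conj_word (s : seq nat) (f : nat -> nat) : nat -> nat :=
  word_prod (rev s) \o f \o word_prod s.

Lemma conj_word_rcons s k f a :
  conj_word (rcons s k) f a = conj_swap k (conj_word s f) a.
Proof. by rewrite /conj_word /conj_swap /= rev_rcons /= word_prod_rcons. Qed.

Lemma inversions_flip h : inversions h.*2 flip = h.
Proof.
rewrite (@eq_inversions _ _ (word_prod [seq t.*2 | t <- iota 0 h])); last first.
  by move=> a ah; rewrite word_prod_evens ah.
suff H k : k <= h -> inversions h.*2 (word_prod [seq t.*2 | t <- iota 0 k]) = k.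
  exact: H.
elim: k => [_|k IH kh]; first by rewrite /inversions big1 // => -[a b] _ /=; lia.
rewrite -[k.+1]addn1 iotaD map_cat /= cats1.
pose w := word_prod [seq t.*2 | t <- iota 0 k].
rewrite (@eq_inversions _ _ (w \o adj_swap k.*2)); last by move=> a _; rewrite word_prod_rcons.
have k2 : k.*2.+1 < h.*2 by lia.
have := inversions_adj_swap k2 (@word_prod_inj _ : injective w).
have wid a : k.*2 <= a -> w a = a.
  by rewrite /w word_prod_evens add0n ltnNge => ->; rewrite andbF.
rewrite !wid ?IH; lia.
Qed.

(** One inversion is lost on each side. The two one-sided products are inverse to each other, so
    they have equally many inversions. *)
Lemma inversions_conj_swap M k z : k.+1 < M -> fpf_on M z -> z k.+1 < z k -> z k != k.+1 ->
  inversions M z = inversions M (conj_swap k z) + 2.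
Proof.
move=> kM zP desc zk; have [zK zf zM] := zP.
have zinj := can_inj zK.
have := inversions_adj_swap kM zinj; rewrite desc ltnNge (ltnW desc) /=.
have sinj : injective (adj_swap k \o z).
  by apply: inj_comp => //; exact: can_inj (@adj_swapK k).
have := inversions_adj_swap kM sinj.
have asc : adj_swap k (z k.+1) < adj_swap k (z k).
  by apply: adj_swap_lt => //; rewrite zk orbT.
rewrite /= asc ltnNge (ltnW asc) /= /conj_swap.
have -> : inversions M (adj_swap k \o z) = inversions M (z \o adj_swap k).
  have lt a : (adj_swap k a < M) = (a < M) by rewrite ltn_adj_swap //; lia.
  apply: inversions_inverse => a /=; rewrite ?zK ?adj_swapK ?zK //.
    by rewrite lt zM.
  by rewrite zM lt.
lia.
Qed.

(* Positions are un-read from the last one on; each either becomes available to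
   chains for free or removes a letter from the involution. *)
Lemma extract_word M (l : seq pos) P z : ~~ odd M -> fpf_on M z ->
    (forall y, P (tr y) = P y) -> (forall y, P y -> y.1 != y.2) ->
    pairwise read_lt l -> all (fun y => y.2 < y.1) l ->
    (forall y, y.2 < y.1 -> (y \in l) || P y) -> bounded M z P ->
  exists d : seq pos, [/\ subseq d l, all (predC P) d,
    all (fun y => (letter y).+1 < M) d,
    forall a, a < M -> z a = conj_word (map letter d) flip a
    & inversions M z = M./2 + (size d).*2].
Proof.
move=> Mev; elim/last_ind: l P z => [|l x IH] P z zP Ptr Pd.
  move=> _ _ Pall zb; exists [::].
  have zflip : forall a, a < M -> z a = flip a.
    apply: bounded_offdiag => // i j c iM jM hc; apply: zb => //.
    apply: sub_chain hc => // y yd; case: (ltngtP y.1 y.2) => h.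
    - by rewrite -Ptr; exact: (Pall (tr y)).
    - exact: (Pall y).
    - by rewrite h eqxx in yd.
  split=> //; rewrite addn0 (eq_inversions zflip) -{1}(odd_double_half M) (negbTE Mev).
  exact: inversions_flip.
rewrite -cats1 pairwise_cat allrel1r all_cat /=.
move=> /and3P[/allP lx lr _] /and3P[llow xlow _] Pall zb.
case: (boolP (P x)) => Px.
  have [|d [d1 d2 d3 d4 d5]] := IH P z zP Ptr Pd lr llow _ zb.
    move=> y /Pall; rewrite mem_cat inE => /orP[/orP[->//|/eqP ->]|->].
      by rewrite Px orbT.
    by rewrite orbT.
  exists d; split=> //; apply: subseq_trans d1 _; exact: prefix_subseq.
have Pafter y : y.2 < y.1 -> read_lt x y -> P y.
  move=> ylow xy; have := Pall y ylow; rewrite mem_cat inE => /orP[/orP[/lx|/eqP yx]|//].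
    by move: xy; rewrite /read_lt; lia.
  by move: xy; rewrite yx /read_lt; lia.
have P'tr := add_pos_tr x Ptr.
have P'd y : add_pos P x y -> y.1 != y.2.
  by move=> /orP[/orP[/Pd //|/eqP ->]|/eqP ->] /=; lia.
have P'all y : y.2 < y.1 -> (y \in l) || add_pos P x y.
  by move=> /Pall; rewrite mem_cat inE /add_pos => /orP[/orP[->|->]|->]; rewrite ?orbT.
(* The cases where [x] becomes available to chains without changing [z]: the positions found for [l]
   serve unchanged. *)
have stay : bounded M z (add_pos P x) -> exists d : seq pos, [/\ subseq d (l ++ [:: x]),
    all (predC P) d, all (fun y => (letter y).+1 < M) d,
    forall a, a < M -> z a = conj_word (map letter d) flip a
    & inversions M z = M./2 + (size d).*2].
  move=> zb'; have [d [d1 d2 d3 d4 d5]] := IH _ z zP P'tr P'd lr llow P'all zb'.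
  exists d; split=> //; first exact: subseq_trans d1 (prefix_subseq _ _).
  by apply: sub_all d2 => y; rewrite /= /add_pos !negb_or => /andP[/andP[]].
set k := x.1 + x.2; have [kM|kM] := leqP M k.+1.
  by apply: stay; apply: bounded_high.
have [asc|desc|] := ltngtP (z k) (z k.+1); last by move/(can_inj (fpfK zP)); lia.
  by apply: stay; apply: bounded_ascent.
have [zk|zk] := eqVneq (z k) k.+1.
  by apply: stay; apply: bounded_link.
have zb' := bounded_descent zP Ptr xlow Pafter zb kM desc zk.
have z'P := fpf_conj_swap kM zP.
have [d [d1 d2 d3 d4 d5]] := IH _ _ z'P P'tr P'd lr llow P'all zb'.
exists (rcons d x); split.
- by rewrite -cats1 cat_subseq.
- rewrite all_rcons /= Px; apply: sub_all d2 => y.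
  by rewrite /= /add_pos !negb_or => /andP[/andP[]].
- by rewrite all_rcons d3 andbT.
- move=> a aM; rewrite map_rcons conj_word_rcons -[letter x]/k /conj_swap /= -d4; last first.
    by rewrite ltn_adj_swap //; lia.
  by rewrite /conj_swap /= !adj_swapK.
- rewrite size_rcons (inversions_conj_swap kM zP desc zk) d5; lia.
Qed.

(** * Symmetric pipe dreams *)

Lemma reading_le_trans : transitive reading_le.
Proof. by move=> y x z; rewrite /reading_le; lia. Qed.

Lemma reading_le_total : total reading_le.
Proof. by move=> x y; rewrite /reading_le; lia. Qed.

Lemma pairwise_sort_read (s : seq pos) : uniq s ->
  pairwise read_lt (sort reading_le s).
Proof.
move=> us; have := sort_sorted reading_le_total s.
rewrite (sorted_pairwise reading_le_trans).
have : uniq (sort reading_le s) by rewrite sort_uniq.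
elim: (sort _ _) => //= x t IH /andP[xt /IH {}IH] /andP[/allP h1 /IH ->].
rewrite andbT; apply/allP => y yt; have := h1 y yt.
have : x != y by apply: contraNneq xt => ->.
by case: x y {h1 xt yt} => [x1 x2] [y1 y2]; rewrite xpair_eqE /reading_le /read_lt /=; lia.
Qed.

(* [x] may precede [y] in a linear extension of the heap of a pipe dream. *)
Definition heap_compat (x y : pos) : bool :=
  ~~ ((y.1 <= x.1) && (x.2 <= y.2)).

Lemma read_lt_heap x y : read_lt x y -> heap_compat x y.
Proof. by rewrite /read_lt /heap_compat; lia. Qed.

(** Positions compatible in both orders lie strictly northwest and southeast of each other, so their
    letters differ by at least two. *)
Lemma heap_compat_far x y : heap_compat x y -> heap_compat y x -> far (letter x) (letter y).
Proof. by rewrite /heap_compat /far /letter; lia. Qed.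

Lemma irr_pairwise_uniq (T : eqType) (r : rel T) s : irreflexive r -> pairwise r s -> uniq s.
Proof.
move=> rI; elim: s => //= x s IH /andP[/allP h /IH ->]; rewrite andbT.
by apply/negP => /h; rewrite rI.
Qed.

Lemma read_lt_irr : irreflexive read_lt.
Proof. by move=> x; rewrite /read_lt; lia. Qed.

Lemma heap_compat_irr : irreflexive heap_compat.
Proof. by move=> x; rewrite /heap_compat; lia. Qed.

(** The symmetric pipe dream with strictly lower part [d], listed as upper half, diagonal, lower
    half. This is not the reading order, but its word is visibly a conjugate of [flip]. *)
Definition fold_word (M : nat) (d : seq pos) : seq pos :=
  rev (map tr d) ++ [seq (t, t) | t <- iota 0 M./2] ++ d.

Lemma fold_word_heap M d : pairwise read_lt d -> all (fun y => y.2 < y.1) d ->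
  pairwise heap_compat (fold_word M d).
Proof.
move=> dr /allP dl; rewrite !pairwise_cat pairwise_rev !pairwise_map.
apply/and5P; split.
- apply/allrelP => x y; rewrite mem_rev mem_cat => /mapP[x' /dl hx ->].
  by case/orP => [/mapP[t _ ->]|/dl]; rewrite /heap_compat /=; lia.
- by apply: sub_pairwise dr => x y; rewrite /read_lt /heap_compat /=; lia.
- by apply/allrelP => x y /mapP[t _ ->] /dl; rewrite /heap_compat /=; lia.
- apply: (sub_pairwise (r := ltn)); first by move=> x y; rewrite /heap_compat /=; lia.
  by rewrite -(sorted_pairwise ltn_trans) iota_ltn_sorted.
- by apply: sub_pairwise dr => x y; exact: read_lt_heap.
Qed.

Lemma word_prod_fold M d a : ~~ odd M -> all (fun y => (letter y).+1 < M) d ->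
  word_prod (map letter (fold_word M d)) a =
    if a < M then conj_word (map letter d) flip a else a.
Proof.
move=> Mev dM; rewrite !map_cat !word_prod_cat map_rev -!map_comp.
have -> : map (letter \o tr) d = map letter d.
  by apply: eq_map => x; rewrite /letter /= addnC.
have -> : map (letter \o (fun t => (t, t))) (iota 0 M./2) = [seq t.*2 | t <- iota 0 M./2].
  by apply: eq_map => t; rewrite /letter /= addnn.
have wM : all (fun k => k.+1 < M) (map letter d) by rewrite all_map.
have wM' : all (fun k => k.+1 < M) (rev (map letter d)) by rewrite all_rev.
have ME : M./2.*2 = M by lia.
rewrite word_prod_evens add0n ME /=; case: (ltnP a M) => aM.
  by rewrite word_prod_ltn // aM /conj_word /flip /=.
by rewrite (word_prod_id wM) // ltnNge aM /= (word_prod_id wM').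
Qed.

Lemma fpf_perm M z : fpf_on M z -> exists y : 'S_M,
  forall a, ext_perm y a = if a < M then z a else a.
Proof.
move=> [zK zf zM].
have zM' (a : 'I_M) : z a < M by rewrite zM.
have finj : injective (fun a : 'I_M => Ordinal (zM' a)).
  by move=> a b /(congr1 val)/=/(can_inj zK)/val_inj.
exists (perm finj) => a; rewrite /ext_perm; case: insubP => [u /= -> <-|/negbTE -> //].
by rewrite permE.
Qed.

Lemma FP_of_word M z (d : seq pos) : ~~ odd M -> fpf_on M z ->
    (forall a, M <= a -> z a = flip a) ->
    pairwise read_lt d -> all (fun y => y.2 < y.1) d ->
    all (fun y => (letter y).+1 < M) d ->
    (forall a, a < M -> z a = conj_word (map letter d) flip a) ->
    inversions M z = M./2 + (size d).*2 ->
  exists2 D, FP z D & forall x, x \in D -> x \in d.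
Proof.
move=> Mev zP ztail dr dl dM zE zinv.
have [y yE] := fpf_perm zP.
pose E : {fset nat * nat} := [fset x in fold_word M d]%fset.
have memE x : (x \in E) = [|| tr x \in d, (x.1 == x.2) && (x.1 < M./2) | x \in d].
  rewrite in_fset /= !mem_cat mem_rev -{1}(trK x) (mem_map (can_inj trK)).
  congr [|| _, _ | _]; apply/mapP/andP => [[t]|[/eqP h1 h2]].
    by rewrite mem_iota => ht ->; rewrite eqxx.
  by exists x.1; rewrite ?mem_iota //; case: x h1 {h2} => a b /= ->.
have sortE : perm_eq (sort reading_le (enum_fset E)) (fold_word M d).
  rewrite perm_sort; apply: uniq_perm; first exact: fset_uniq.
    exact: irr_pairwise_uniq heap_compat_irr (fold_word_heap M dr dl).
  by move=> x; rewrite in_fset.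
clearbody E.
(* The reading order and the folded order are both compatible with the heap of [E], so they give the
   same product. *)
have wordE : word_prod (reading_word E) =1 ext_perm y.
  move=> a; have sr := pairwise_sort_read (fset_uniq E).
  rewrite /reading_word (@word_prod_heap _ heap_compat letter _ (fold_word M d)) //.
  - by rewrite word_prod_fold // yE; case: ifP => // /zE ->.
  - by move=> x x' h1 h2 _; exact: heap_compat_far.
  - by rewrite sort_uniq fset_uniq.
  - by apply: sub_pairwise sr => x x'; exact: read_lt_heap.
  - exact: fold_word_heap.
exists (strict_lower E); last first.
  by move=> x; rewrite !inE /= memE => /andP[/or3P[/(allP dl)||//]] /=; lia.
exists M, y; split=> //.
- apply/permP => a; rewrite permM perm1; apply: val_inj => /=.
  have := yE (y a); have := yE a; rewrite /ext_perm !valK !ltn_ord => -> ->.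
  exact: fpfK zP _.
- move=> a; rewrite -val_eqE /=; have := yE a; rewrite /ext_perm valK ltn_ord => ->.
  exact: fpf_neq zP _.
- move=> a; rewrite /= yE /swap_tail; case: (ltnP a M) => aM; first by rewrite aM.
  by rewrite ztail // /flip; do ![case: ifP => ?]; lia.
exists E; split=> //.
  have Etr x : x \in E -> tr x \in E.
    rewrite !memE trK => /or3P[h|h|h]; apply/or3P; [exact: Or33| |exact: Or31].
    by apply: Or32; case: x h => a b /= /andP[/eqP -> ->]; rewrite eqxx.
  apply/fsetP => x; apply/idP/imfsetP => /= [h|[x' + ->]]; last exact: Etr.
  by exists (tr x); rewrite ?Etr //; case: x {h}.
split=> // t tE.
(* A competing word may use letters beyond M, so inversions are compared in a larger window. *)
have [N MN tN] : exists2 N, M <= N & all (fun k => k.+1 < N) t.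
  exists (maxn M (\max_(l <- t) l).+2); first exact: leq_maxl.
  apply/allP => l lt; rewrite leq_max !ltnS; apply/orP; right.
  exact: (@leq_bigmax_seq _ t xpredT id l lt isT).
have -> : size (reading_word E) = inversions M z.
  by rewrite size_map (perm_size sortE) !size_cat size_rev !size_map size_iota zinv -addnn addnCA.
apply: leq_trans (inversions_word_prod tN).
rewrite (@eq_inversions N (word_prod t) (ext_perm y)) //; apply: leq_trans (leq_inversions _ MN).
by rewrite (@eq_inversions M z (ext_perm y)) // => a aM; rewrite yE aM.
Qed.

(** * Chains avoiding a pipe dream *)

Lemma rk_word_prod s f i j : all (fun k => k.+1 != j) s ->
  rk (word_prod s \o f) i j = rk f i j.
Proof.
elim: s => [|k s IH] /= => [_|/andP[kj /IH <-]]; first exact: eq_rk.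
by rewrite -(@rk_swap_adj k (word_prod s \o f) i j) // eq_sym.
Qed.

Lemma leq_rk_succ f i j : injective f -> rk f i j.+1 <= (rk f i j).+1.
Proof.
move=> finj.
have -> : rk f i j.+1 = rk f i j + \sum_(a < i) (f a == j).
  by rewrite /rk -big_split /=; apply: eq_bigr => a _; rewrite ltnS leq_eqVlt; lia.
rewrite -[(rk f i j).+1]addn1 leq_add2l.
case: (pickP (fun a : 'I_i => f a == j)) => [a fa|no]; last by rewrite big1 // => a _; rewrite no.
rewrite (bigD1 a) //= fa big1 // => b ba; case: eqP => // fb.
by move: ba; rewrite -val_eqE /= (finj _ _ (etrans fb (esym (eqP fa)))) eqxx.
Qed.

Lemma rk_id i : rk id i i = i.
Proof.
rewrite /rk (eq_bigr (fun=> 1)) ?sum1_card ?card_ord //.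
by case=> a ai _ /=; rewrite ai.
Qed.

Lemma chain_rows_nil P i j c p : chain P i j c -> all (fun x => p <= x.1) c ->
  i <= p -> c = [::].
Proof.
move=> /chainP[_ h2] cp ip; case: c h2 cp => //= x c h2 /andP[px _].
by have [|_ xi _] := h2 x; [exact: mem_head | move: (leq_trans xi ip); rewrite ltnNge px].
Qed.

Section Rows.
Variables (N : nat) (Q : pred pos).

Definition grid_row (p : nat) : seq pos :=
  [seq x <- [seq (p, q) | q <- rev (iota 0 N)] | Q x].

Definition grid_rows (p k : nat) : seq pos := flatten [seq grid_row t | t <- iota p k].

Lemma mem_grid_row p x : x \in grid_row p -> [/\ Q x, x.1 = p & x.2 < N].
Proof.
rewrite mem_filter => /andP[Qx /mapP[q]].
by rewrite mem_rev mem_iota => /= hq xE; split=> //; rewrite xE.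
Qed.

Lemma grid_row_split p r : r <= N -> exists s t, [/\ grid_row p = s ++ t,
  forall x, x \in s -> [/\ Q x, x.1 = p & r <= x.2] &
  forall x, x \in t -> [/\ Q x, x.1 = p & x.2 < r]].
Proof.
move=> rN; rewrite /grid_row -(subnKC rN) iotaD rev_cat map_cat filter_cat.
eexists; eexists; split; first reflexivity.
- move=> x; rewrite mem_filter => /andP[Qx /mapP[q]].
  by rewrite mem_rev mem_iota => /andP[hq _] xE; split=> //; rewrite xE.
- move=> x; rewrite mem_filter => /andP[Qx /mapP[q]].
  by rewrite mem_rev mem_iota => hq xE; split=> //; rewrite xE.
Qed.

Lemma grid_rows_pairwise p k : pairwise read_lt (grid_rows p k).
Proof.
elim: k p => //= k IH p; rewrite /grid_rows /= pairwise_cat IH andbT.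
apply/andP; split.
  apply/allrelP => x y /mem_grid_row[_ xp _] /flatten_mapP[t].
  by rewrite mem_iota => ht /mem_grid_row[_ yt _]; rewrite /read_lt xp yt; lia.
apply: subseq_pairwise (filter_subseq _ _) _.
rewrite pairwise_map pairwise_rev; apply: (sub_pairwise (r := ltn)).
  by move=> a b; rewrite /read_lt /=; lia.
by rewrite -(sorted_pairwise ltn_trans) iota_ltn_sorted.
Qed.

(** The least number of initial columns that contain a chain: its first point is the rightmost
    one. *)
Definition top (c : seq pos) : nat := if c is x :: _ then x.2.+1 else 0.

Definition grid_prod (p k : nat) : nat -> nat := word_prod (map letter (grid_rows p k)).

Lemma grid_prodS p k a :
  grid_prod p k.+1 a = word_prod (map letter (grid_row p)) (grid_prod p.+1 k a).
Proof. by rewrite /grid_prod /grid_rows /= map_cat word_prod_cat. Qed.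

(* Reading the rows upwards, the values below p + top are never lost except one
   per row without a point of the chain. *)
Lemma chain_rk_rows i j c p k : j <= N -> p <= i <= p + k ->
  chain (predC Q) i j c -> all (fun x => p <= x.1) c ->
  p + size c <= rk (grid_prod p k) i (p + top c).
Proof.
move=> jN; elim: k p c => [|k IH] p c hp hc cp.
  have pi : p = i by lia.
  rewrite (chain_rows_nil hc cp) ?pi // /grid_prod /= !addn0 rk_id //.
have [pi|pne] := eqVneq p i.
  rewrite (chain_rows_nil hc cp) ?pi // /= !addn0 -(@eq_rk (grid_prod i k.+1 \o id)) //.
  rewrite rk_word_prod ?rk_id //.
  apply/allP => l /mapP[x /flatten_mapP[t]]; rewrite mem_iota => ht.
  by case/mem_grid_row=> _ xt _ ->; rewrite /letter xt; lia.
have hp' : p.+1 <= i <= p.+1 + k by lia.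
have tj : top c <= j.
  by case: c hc {cp} => //= x c /chainP[_ h]; have [|//] := h x; exact: mem_head.
have skip : all (fun x => p.+1 <= x.1) c -> p + size c <= rk (grid_prod p k.+1) i (p + top c).
  move=> cp'; have := IH _ _ hp' hc cp'.
  (* Letters from columns below [top c] preserve the rank at p + 1 + top c, and the others preserve
     it at p + top c. Lowering the bound by one in between loses at most one value. *)
  have [s [t [st hs ht]]] := @grid_row_split p (top c) (leq_trans tj jN).
  rewrite (@eq_rk (grid_prod p k.+1) (word_prod (map letter s) \o
    (word_prod (map letter t) \o grid_prod p.+1 k))); last first.
    by move=> a _; rewrite grid_prodS st map_cat word_prod_cat.
  rewrite [X in _ -> _ <= X]rk_word_prod; last first.
    by apply/allP => l /mapP[x /hs[_ xp hx] ->]; rewrite /letter xp gtn_eqF // ltnS leq_add2l hx.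
  rewrite -(@rk_word_prod (map letter t) (grid_prod p.+1 k)); last first.
    by apply/allP => l /mapP[x /ht[_ xp hx] ->]; rewrite /letter xp addSn eqSS eqn_add2l ltn_eqF.
  rewrite !addSn => h; have := leq_trans h (leq_rk_succ _ _ _); rewrite ltnS; apply.
  by apply: inj_comp; exact: word_prod_inj.
case: c hc cp tj skip => [|x c] hc cp tj skip; first exact: skip.
have [xp|xp] := eqVneq x.1 p; last first.
  apply: skip; apply/allP => y; rewrite inE => /orP[/eqP ->|yc].
    by have := allP cp x (mem_head _ _); lia.
  move: hc => /andP[/= /andP[/allP h1 _] _]; have /andP[h2 _] := h1 y yc.
  by have := allP cp x (mem_head _ _); move=> h3; exact: leq_ltn_trans h3 h2.
have /chainP[/= /andP[/allP h1 h1'] h2] := hc.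
have hc' : chain (predC Q) i j c by apply: subseq_chain hc; exact: subseq_cons.
have := IH p.+1 c hp' hc' _; have -> : all (fun y => p.+1 <= y.1) c.
  by apply/allP => y /h1/andP[]; rewrite xp.
move=> /(_ isT) h3.
rewrite (@eq_rk (grid_prod p k.+1) (word_prod (map letter (grid_row p)) \o grid_prod p.+1 k)); last first.
  by move=> a _; rewrite grid_prodS.
(* Only the letter p + x.2 could change this rank, and row p of [Q] lacks it because [x] is not in
   [Q]. *)
rewrite rk_word_prod; last first.
  apply/allP => l /mapP[y yr ->]; have [Qy yp _] := mem_grid_row yr.
  rewrite /letter yp /= addnS eqSS eqn_add2l; apply: contraTneq Qy => yx.
  have [Qx _ _] := h2 x (mem_head _ _).
  by have -> : y = x by rewrite [y]surjective_pairing [x]surjective_pairing yx yp xp.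
apply: leq_trans (leq_trans h3 (leq_rkr _ _ _)); first by rewrite /= addSnnS.
rewrite addSnnS leq_add2l /=; case: c h1 {h1' h2 hc hc' cp tj skip h3} => //= y c h1.
by have /andP[] := h1 y (mem_head _ _).
Qed.

Lemma chain_rk i j c : i <= N -> j <= N -> chain (predC Q) i j c ->
  size c <= rk (grid_prod 0 N) i j.
Proof.
move=> iN jN hc; have hi : 0 <= i <= 0 + N by lia.
have := chain_rk_rows jN hi hc; rewrite all_predT !add0n => /(_ isT) h.
apply: leq_trans h (leq_rkr _ _ _).
by case: c hc => //= x c /chainP[_ h]; have [|//] := h x; exact: mem_head.
Qed.

End Rows.

Lemma swap_tailE m a : ~~ odd m -> swap_tail m a = if a < m then a else flip a.
Proof. by rewrite /swap_tail /flip => mev; do ![case: ifP => ?]; lia. Qed.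

(* A reduced pipe dream of [y] in [S_m] uses letters below m - 1 only, so adding
   the diagonal positions (t, t) with 2t >= m multiplies by the tail of [z]. *)
Lemma FP_chain_rk z D i j c : FP z D ->
  chain (fun x => [&& x.1 != x.2, x \notin D & tr x \notin D]) i j c ->
  size c <= rk z i j.
Proof.
case=> m [y [mev yinv yf zE [E [Esym Ered ->]]]] hc.
have Elet := reduced_word_letters Ered (m := m).
have {}Elet : all (fun k => k.+1 < m) (reading_word E).
  apply: Elet => a ma; rewrite /ext_perm; case: insubP => // u; lia.
have Em (x : pos) : x \in E -> (letter x).+1 < m.
  move=> xE; apply: (allP Elet); apply/mapP; exists x => //.
  by rewrite mem_sort.
have Etr (x : pos) : (tr x \in E) = (x \in E).
  have H (w : pos) : w \in E -> tr w \in E.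
    by move=> wE; rewrite Esym; apply/imfsetP; exists w.
  by apply/idP/idP => /H; rewrite ?trK.
pose N := maxn m (maxn i j).
pose Q (x : pos) := (x \in E) || (x.1 == x.2) && (m <= x.1.*2).
pose tail := [seq (t, t) | t <- iota m./2 (N - m./2)].
have mem_tail (x : pos) : (x \in tail) = [&& x.1 == x.2, m <= x.1.*2 & x.1 < N].
  apply/mapP/and3P => [[t]|[/eqP h1 h2 h3]].
    by rewrite mem_iota => ht -> /=; split; lia.
  exists x.1; first by rewrite mem_iota; lia.
  by rewrite [x in LHS]surjective_pairing -h1.
(* The tail is placed after all of [E], possibly against the heap order; [far] permits this because
   its letters commute with those of [E]. *)
pose r x x' := heap_compat x x' || far (letter x) (letter x').
have mN : m <= N by rewrite leq_maxl.
have tail_far (x x' : pos) : x \in E -> x' \in tail -> far (letter x) (letter x').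
  rewrite mem_tail => /Em xm /and3P[/eqP h1 h2 _].
  by rewrite /far {2}/letter -h1 addnn (leq_trans xm h2).
have sE := pairwise_sort_read (fset_uniq E).
have perm : perm_eq (grid_rows N Q 0 N) (sort reading_le (enum_fset E) ++ tail).
  apply: uniq_perm.
  - exact: irr_pairwise_uniq read_lt_irr (grid_rows_pairwise _ _ _ _).
  - rewrite cat_uniq sort_uniq fset_uniq /=; apply/andP; split.
      apply/hasPn => x xt; apply/negP; rewrite mem_sort => xE.
      by have := tail_far _ _ xE xt; rewrite /far; lia.
    by rewrite map_inj_uniq ?iota_uniq // => a b [].
  move=> x0; pose x : pos := x0; rewrite -/x; clearbody x => {x0}.
  rewrite mem_cat mem_sort mem_tail; apply/flatten_mapP/orP => [[t]|].
    rewrite mem_iota => ht /mem_grid_row[/orP[xE|/andP[h1 h2]] xt _]; first by left.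
    by right; rewrite h1 h2 xt; case/andP: ht.
  move=> h; have [x1 x2] : x.1 < N /\ x.2 < N.
    case: h => [/Em|/and3P[/eqP <- _ //]].
    by rewrite /letter => xm; split; apply: leq_trans mN; lia.
  exists x.1; first by rewrite mem_iota.
  rewrite mem_filter; apply/andP; split.
    by case: h => [xE|/and3P[h1 h2 _]]; rewrite /Q ?xE // h1 h2 orbT.
  apply/mapP; exists x.2; last exact: surjective_pairing.
  by rewrite mem_rev mem_iota.
have zprod a : a < N -> grid_prod N Q 0 N a = z a.
  move=> aN; rewrite /grid_prod (@word_prod_heap _ r letter _ _ _ _ _ _ perm).
  - rewrite map_cat word_prod_cat -map_comp (eq_map (g := fun t => t.*2)).
      rewrite (Ered.1 _) word_prod_evens zE /= swap_tailE // /flip.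
      congr (ext_perm y _); do ![case: ifP => ?]; lia.
    by move=> t; rewrite /letter /= addnn.
  - move=> x x'; rewrite /r => /orP[h1|//] /orP[h2 _|h2 _]; first exact: heap_compat_far.
    by rewrite /far orbC; exact: h2.
  - exact: irr_pairwise_uniq read_lt_irr (grid_rows_pairwise _ _ _ _).
  - apply: sub_pairwise (grid_rows_pairwise _ _ _ _) => x x' h.
    by rewrite /r read_lt_heap.
  - rewrite pairwise_cat; apply/and3P; split.
    + by apply/allrelP => x x'; rewrite mem_sort /r => h1 h2; rewrite tail_far ?orbT.
    + by apply: sub_pairwise sE => x x' h; rewrite /r read_lt_heap.
    rewrite pairwise_map; apply: (sub_pairwise (r := ltn)).
      by move=> t t'; rewrite /r /heap_compat /=; lia.
    by rewrite -(sorted_pairwise ltn_trans) iota_ltn_sorted.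
have <- : rk (grid_prod N Q 0 N) i j = rk z i j.
  by apply: eq_rk => a ai; apply: zprod; rewrite /N; lia.
apply: chain_rk; [by rewrite /N; lia | by rewrite /N; lia |].
(* Off the diagonal, the symmetric set [E] consists of its strictly lower part and the transpose of
   that part. *)
apply: sub_chain hc => // x /and3P[xd]; rewrite /= /Q (negbTE xd) orbF !inE /= Etr.
by case: (x \in E) => //=; move: xd; lia.
Qed.

(** * Monomial ideals *)

Definition ord_pos (n : nat) (x : 'I_n * 'I_n) : pos := (nat_of_ord x.1, nat_of_ord x.2).

Lemma sorted_enum_val n (A : {set 'I_n}) : sorted ltn (map val (enum A)).
Proof.
have -> : enum A = [seq a <- enum 'I_n | a \in A] by rewrite enumT.
apply: (@subseq_sorted _ _ ltn_trans _ (map val (enum 'I_n))).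
  by apply: map_subseq; exact: filter_subseq.
by rewrite val_enum_ord iota_ltn_sorted.
Qed.

Lemma map_odot n (A B : {set 'I_n}) :
  map (@ord_pos n) (odot A B) = zip (map val (enum A)) (rev (map val (enum B))).
Proof.
rewrite /odot -map_rev; elim: (enum A) (rev (enum B)) => [|a s IH] [|b t] //=.
by rewrite IH.
Qed.

Lemma mem_zip (S T : eqType) (s : seq S) (t : seq T) x :
  x \in zip s t -> (x.1 \in s) && (x.2 \in t).
Proof.
elim: s t => [|a s IH] [|b t] //=; rewrite !inE => /orP[/eqP -> /=|/IH/andP[-> ->]].
  by rewrite !eqxx.
by rewrite !orbT.
Qed.

Lemma pairwise_chain_zip (s t : seq nat) : pairwise ltn s ->
  pairwise (fun a b => b < a) t -> pairwise chain_lt (zip s t).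
Proof.
elim: s t => [|a s IH] [|b t] //= /andP[/allP h1 h2] /andP[/allP h3 h4].
rewrite IH // andbT; apply/allP => x /mem_zip/andP[/h1 h /h3 h'].
by apply/andP.
Qed.

Lemma odot_chain n (A B : {set 'I_n}) : pairwise chain_lt (map (@ord_pos n) (odot A B)).
Proof.
rewrite map_odot; apply: pairwise_chain_zip.
  by rewrite -(sorted_pairwise ltn_trans) sorted_enum_val.
by rewrite pairwise_rev -(sorted_pairwise ltn_trans) sorted_enum_val.
Qed.

Lemma mem_odot n (A B : {set 'I_n}) x : x \in odot A B -> (x.1 \in A) && (x.2 \in B).
Proof.
case: x => a b xo; have : (a \in enum A) && (b \in rev (enum B)) by exact: mem_zip xo.
by rewrite mem_rev !mem_enum.
Qed.

Lemma map_val_enum n (s : seq nat) : sorted ltn s -> all (fun a => a < n) s ->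
  map val (enum [set a : 'I_n | val a \in s]) = s.
Proof.
move=> ss sn; apply: (irr_sorted_eq ltn_trans ltnn) => //; first exact: sorted_enum_val.
move=> a; apply/mapP/idP => [[b + ->]|as_]; first by rewrite mem_enum inE.
by exists (Ordinal (allP sn a as_)); rewrite // mem_enum inE.
Qed.

Lemma odot_of_chain n P i j c : i <= n -> j <= n -> chain P i j c ->
  exists A B : {set 'I_n}, [/\ map (@ord_pos n) (odot A B) = c,
    #|A| = size c, #|B| = size c,
    (forall a, a \in A -> a < i) & (forall b, b \in B -> b < j)].
Proof.
move=> iN jN /chainP[h1 h2].
have s1 : sorted ltn (unzip1 c).
  by apply: pairwise_sorted; rewrite pairwise_map; apply: sub_pairwise h1 => x y /andP[].
have s2 : sorted ltn (rev (unzip2 c)).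
  apply: pairwise_sorted; rewrite pairwise_rev pairwise_map.
  by apply: sub_pairwise h1 => x y /andP[].
have b1 : all (fun a => a < i) (unzip1 c).
  by apply/allP => a /mapP[x /h2[_ h _] ->].
have b2 : all (fun a => a < j) (rev (unzip2 c)).
  by rewrite all_rev; apply/allP => a /mapP[x /h2[_ _ h] ->].
have n1 : all (fun a => a < n) (unzip1 c).
  by apply: sub_all b1 => a ai; exact: leq_trans ai iN.
have n2 : all (fun a => a < n) (rev (unzip2 c)).
  by apply: sub_all b2 => a ai; exact: leq_trans ai jN.
have e1 := map_val_enum s1 n1; have e2 := map_val_enum s2 n2.
exists [set a : 'I_n | val a \in unzip1 c], [set a : 'I_n | val a \in rev (unzip2 c)].
split.
- by rewrite map_odot e1 e2 revK zip_unzip.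
- by rewrite cardE -(size_map val) e1 size_map.
- by rewrite cardE -(size_map val) e2 size_rev size_map.
- by move=> a; rewrite inE => /(allP b1).
- by move=> a; rewrite inE => /(allP b2).
Qed.

Section Ideals.
Local Open Scope ring_scope.
Variables (R : comNzRingType) (G : R -> Prop).

Lemma ideal_gen0 : ideal_gen G 0.
Proof. by exists 0, (fun=> 0), (fun=> 0); split=> [[]|]; rewrite // big_ord0. Qed.

Lemma ideal_genD f g : ideal_gen G f -> ideal_gen G g -> ideal_gen G (f + g).
Proof.
move=> [k [c [u [hu ->]]]] [l [d [v [hv ->]]]].
exists (k + l)%N, (fun i => match split i with inl a => c a | inr b => d b end),
  (fun i => match split i with inl a => u a | inr b => v b end); split.
  by move=> i; case: (split i).
rewrite big_split_ord; congr (_ + _); apply: eq_bigr => i _.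
  by rewrite (unsplitK (inl i)).
by rewrite (unsplitK (inr i)).
Qed.

Lemma ideal_genM a f : ideal_gen G f -> ideal_gen G (a * f).
Proof.
move=> [k [c [u [hu ->]]]]; exists k, (fun i => a * c i), u; split=> //.
by rewrite mulr_sumr; apply: eq_bigr => i _; rewrite mulrA.
Qed.

Lemma ideal_gen_mem g : G g -> ideal_gen G g.
Proof.
by move=> Gg; exists 1%N, (fun=> 1), (fun=> g); split=> //; rewrite big_ord1 mul1r.
Qed.

Lemma ideal_gen_sum (I : eqType) (r : seq I) (F : I -> R) :
  (forall i, i \in r -> ideal_gen G (F i)) -> ideal_gen G (\sum_(i <- r) F i).
Proof.
elim: r => [|i r IH] h; first by rewrite big_nil; exact: ideal_gen0.
rewrite big_cons; apply: ideal_genD; first exact: h (mem_head _ _).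
by apply: IH => k kr; apply: h; rewrite inE kr orbT.
Qed.

End Ideals.

Section Monomials.
Local Open Scope ring_scope.
Variables (K : fieldType) (n : nat).
Implicit Types (m : 'X_{1..#|lower_pair n|}) (p : lower_pair n).

(** A monomial of a sum occurs in one of the summands, and there it is a multiple of a variable. *)
Lemma variable_ideal_msupp D (f : {mpoly K[#|lower_pair n|]}) m :
  @variable_ideal K n D f -> m \in msupp f ->
  exists2 p, ord_pos (val p) \in D & (0 < m (enum_rank p))%N.
Proof.
move=> [k [a [g [hg ->]]]] mf.
case: (pickP (fun l => m \in msupp ((a l : {mpoly K[_]}) * (g l : {mpoly K[_]})))) => [l|none].
  have [p [pD ->]] := hg l; rewrite /uvar (perm_mem (msuppMX _ _)) => /mapP[m' _ ->].
  by exists p => //; rewrite mnmDE mnm1E eqxx.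
move: mf; rewrite mcoeff_msupp raddf_sum big1 ?eqxx // => l _.
by apply/eqP; rewrite mcoeff_eq0 none.
Qed.

Lemma dvd_monomial (S : pred (lower_pair n)) m :
  (forall p, S p -> (0 < m (enum_rank p))%N) ->
  exists h : skew_ring K n, 'X_[m] = h * \prod_(p | S p) uvar K p.
Proof.
(* The truth value [S p] counts as 0 or 1: the cofactor lowers the exponents on [S] by one. *)
move=> hS; exists (\prod_p (uvar K p ^+ (m (enum_rank p) - S p))).
rewrite mpolyXE_id (reindex enum_rank) /=; last exact: onW_bij (enum_rank_bij _).
rewrite [X in _ = _ * X]big_mkcond -big_split; apply: eq_bigr => p _.
case: ifP => [Sp|_]; last by rewrite /= subn0 mulr1.
by rewrite /= subn1 -exprSr prednK // hS.
Qed.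

End Monomials.

(** * The image of FPF *)

Section FPFImage.
Variables (n : nat) (y : 'S_n).
Hypothesis yinv : perm_involution y.
Let s := fixpts y.
Let M := n + size s.

Lemma ext_permK : involutive (ext_perm y).
Proof.
move=> a; rewrite {2}/ext_perm; case: insubP => [i _ <-|].
  by rewrite /ext_perm valK -permM yinv perm1.
by rewrite /ext_perm; case: insubP => // i ->.
Qed.

Lemma ext_perm_ltn a : (ext_perm y a < n) = (a < n).
Proof. by rewrite /ext_perm; case: insubP => [i -> _|//]; rewrite ltn_ord. Qed.

Lemma mem_fixpts a : (a \in s) = (a < n) && (ext_perm y a == a).
Proof.
apply/mapP/andP => [[i]|[an]].
  by rewrite mem_filter => /andP[/eqP yi _] ->; rewrite /ext_perm valK yi ltn_ord.
rewrite -[a]/(val (Ordinal an)) /ext_perm valK val_eqE => yi.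
by exists (Ordinal an); rewrite // mem_filter yi mem_enum.
Qed.

Lemma fixpts_uniq : uniq s.
Proof.
by rewrite (map_inj_uniq val_inj); apply: filter_uniq; exact: enum_uniq.
Qed.

Lemma FPF_moved a : a < n -> a \notin s -> FPF y a = ext_perm y a.
Proof.
move=> an as_; rewrite /FPF /= /swap_tail (leq_trans an (leq_addr _ _)).
by rewrite /link_tail -/s (negbTE as_) leqNgt an.
Qed.

Lemma ext_perm_ge a : n <= a -> ext_perm y a = a.
Proof. by rewrite /ext_perm; case: insubP => // i; rewrite ltnNge => /negbTE ->. Qed.

Lemma FPF_fixed a : a \in s -> FPF y a = n + index a s.
Proof.
move=> as_; have /andP[an _] : (a < n) && (ext_perm y a == a) by rewrite -mem_fixpts.
rewrite /FPF /= /swap_tail (leq_trans an (leq_addr _ _)) /link_tail -/s as_.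
by rewrite ext_perm_ge // leq_addr.
Qed.

Lemma FPF_link a : n <= a < M -> FPF y a = nth 0 s (a - n).
Proof.
move=> /andP[na aM]; rewrite /FPF /= /swap_tail aM /link_tail -/s.
have -> : (a \in s) = false by rewrite mem_fixpts ltnNge na.
rewrite na aM /=; have : nth 0 s (a - n) \in s by apply: mem_nth; rewrite ltn_subLR.
by rewrite mem_fixpts => /andP[_ /eqP].
Qed.

Lemma FPF_tail a : M <= a -> FPF y a = M + flip (a - M).
Proof.
move=> Ma; rewrite /FPF /= /swap_tail -/s -/M ltnNge Ma /= -/(flip (a - M)).
have le : M <= M + flip (a - M) by rewrite leq_addr.
have nM : n <= M by rewrite leq_addr.
rewrite /link_tail -/s -/M.
have -> : (M + flip (a - M) \in s) = false by rewrite mem_fixpts; lia.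
have -> : n <= M + flip (a - M) < M = false by lia.
by rewrite ext_perm_ge //; lia.
Qed.

Lemma flipK : involutive flip.
Proof. by move=> a; rewrite /flip; do ![case: ifP]; lia. Qed.

(** There are four blocks: the moved points below n and the tail from M on are each preserved, while
    the fixed points are exchanged with the interval from n to M. *)
Lemma FPF_fpf : fpf_on M (FPF y).
Proof.
have nM : n <= M by rewrite leq_addr.
have cases a : [\/ a < n /\ a \notin s, a \in s, n <= a < M | M <= a].
  case: (boolP (a \in s)) => as_; first exact: Or42.
  case: (ltnP a n) => an; first exact: Or41.
  by case: (ltnP a M) => aM; [exact: Or43 | exact: Or44].
have slt a : a \in s -> a < n by rewrite mem_fixpts => /andP[].
have idx a : a \in s -> n <= n + index a s < M.
  by move=> as_; rewrite leq_addr ltn_add2l index_mem.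
have nthm a : n <= a < M -> nth 0 s (a - n) \in s.
  by move=> /andP[na aM]; apply: mem_nth; rewrite ltn_subLR.
have ext_s a : a < n -> a \notin s -> ext_perm y a \notin s.
  by move=> an; rewrite !mem_fixpts ext_perm_ltn an /= ext_permK eq_sym.
split=> a; case: (cases a) => [[an as_]|as_|aM|aM].
- by rewrite (FPF_moved an as_) FPF_moved ?ext_permK ?ext_perm_ltn ?ext_s.
- by rewrite (FPF_fixed as_) (FPF_link (idx _ as_)) addKn nth_index.
- rewrite (FPF_link aM) FPF_fixed ?nthm // index_uniq ?fixpts_uniq //.
    by rewrite subnKC //; case/andP: aM.
  by case/andP: aM => na aM; rewrite ltn_subLR.
- by rewrite (FPF_tail aM) FPF_tail ?leq_addr // addKn flipK subnKC.
- by rewrite (FPF_moved an as_); move: as_; rewrite mem_fixpts an.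
- by rewrite (FPF_fixed as_); have := slt _ as_; lia.
- by rewrite (FPF_link aM); have := slt _ (nthm _ aM); lia.
- by rewrite (FPF_tail aM) /flip; case: ifP; lia.
- by rewrite (FPF_moved an as_) (leq_trans an nM) (leq_trans _ nM) // ext_perm_ltn.
- rewrite (FPF_fixed as_) (leq_trans (slt _ as_) nM).
  by case/andP: (idx _ as_) => _ ->.
- by rewrite (FPF_link aM) (leq_trans (slt _ (nthm _ aM)) nM); case/andP: aM => _ ->.
- by rewrite (FPF_tail aM) ltnNge leq_addr ltnNge aM.
Qed.

End FPFImage.

(** M is even because it is the rank of [z] at the corner (M, M). Hence the tail starting at M
    agrees with [flip]. *)
Lemma FPF_image_fpf n z : FPF_image n z ->
  exists M, [/\ ~~ odd M, n <= M, fpf_on M z & forall a, M <= a -> z a = flip a].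
Proof.
move=> [y [yinv zE]]; pose M := n + size (fixpts y).
have [K1 K2 K3] := FPF_fpf yinv.
have zP : fpf_on M z by split=> a; rewrite !zE; [exact: K1 | exact: K2 | exact: K3].
have Mev : ~~ odd M.
  by rewrite -{1}(rk_fpf_full zP (leqnn M)); apply: rk_diag_even; case: zP.
exists M; split=> //; first exact: leq_addr.
by move=> a aM; rewrite zE FPF_tail // -/M /flip; do ![case: ifP]; lia.
Qed.

(** * Generators, monomials and the two inclusions *)

Definition uss_support n (A B : {set 'I_n}) : pred (lower_pair n) := fun p =>
  (val p \in odot A B) || (((val p).2, (val p).1) \in odot A B).

Lemma ussE (K : fieldType) n (A B : {set 'I_n}) :
  {in odot A B, forall x, x.1 != x.2} ->
  uss K A B = (\prod_(p | uss_support A B p) uvar K p)%R.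
Proof. by move/hasPn/negbTE; rewrite /uss => ->. Qed.

(** If no variable of the product had its position in [D], the positions of [odot A B] would form a
    chain avoiding [D] and its transpose, one point longer than [FP_chain_rk] allows. *)
Lemma uss_mem_variable_ideal (K : fieldType) n z D i j (A B : {set 'I_n}) : FP z D ->
    (forall a, a \in A -> a < i) -> (forall b, b \in B -> b < j) ->
    #|A| = (rank_corner z i j).+1 -> #|B| = (rank_corner z i j).+1 ->
  variable_ideal D (uss K A B).
Proof.
move=> zD Ai Bj cA cB.
case: (boolP (has (fun x => x.1 == x.2) (odot A B))) => [diag|/hasPn nodiag].
  by rewrite /uss diag; exact: ideal_gen0.
rewrite ussE //; set S := uss_support A B.
case: (pickP (fun p => S p && (ord_pos (val p) \in D))) => [p /andP[Sp pD]|none].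
  rewrite (bigD1 p) //= mulrC; apply: ideal_genM; apply: ideal_gen_mem.
  by exists p.
have low x : x \in D -> x.2 < x.1.
  by case: zD => m [y [_ _ _ _ [E [_ _ ->]]]]; rewrite !inE /= => /andP[].
pose c := map (@ord_pos n) (odot A B).
have : chain (fun x => [&& x.1 != x.2, x \notin D & tr x \notin D]) i j c.
  apply/chainP; split; first exact: odot_chain.
  move=> _ /mapP[x xo ->]; have /andP[xA xB] := mem_odot xo.
  split; [| exact: Ai | exact: Bj].
  have xd := nodiag x xo; apply/and3P; split; first by rewrite /= val_eqE.
    apply/negP => xD; have := none (Sub x (low _ xD) : lower_pair n).
    by rewrite /S /uss_support SubK xo /= xD.
  apply/negP => xD; have := none (Sub (x.2, x.1) (low _ xD) : lower_pair n).
  rewrite /S /uss_support SubK /= -surjective_pairing xo orbT /=.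
  by move/negbT/negP; apply; exact: xD.
move/(FP_chain_rk zD); rewrite size_map /odot size_zip size_rev -!cardE cA cB minnn.
by rewrite rk_cornerE ltnn.
Qed.

Section Main.
Variables (K : fieldType) (n : nat) (z : nat -> nat).
Hypothesis hz : FPF_image n z.
Implicit Types (m : 'X_{1..#|lower_pair n|}) (p : lower_pair n).

Definition monomial_pos m : pred pos := fun x =>
  [exists p : lower_pair n, (ord_pos (val p) == x) && (0 < m (enum_rank p))].

Lemma monomial_pos_lower m x : monomial_pos m x -> (x.2 < x.1) && (x.1 < n).
Proof.
by case/existsP => p /andP[/eqP <- _] /=; rewrite ltn_ord andbT; exact: (valP p).
Qed.

(** The chain, transposed if i < j and cut down to one point more than the rank, is the set of
    positions of a generator, which divides the monomial. *)
Lemma Jss_of_chain m i j c : i <= n -> j <= n ->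
    chain (fun x => monomial_pos m x || monomial_pos m (tr x)) i j c ->
    rk z i j < size c ->
  Jss z ('X_[m] : skew_ring K n).
Proof.
have zK : involutive z by have [M [_ _ []]] := FPF_image_fpf hz.
set P := fun x => _; have Ptr x : P (tr x) = P x by rewrite /P trK orbC.
wlog ji : i j c / j <= i.
  move=> H iN jN hc rc; case: (leqP j i) => ij; first exact: (H i j c).
  apply: (H j i (rev (map tr c))) => //; first exact: ltnW.
    by rewrite chain_tr.
  by rewrite size_rev size_map rkC.
move=> iN jN hc rc.
have hc' : chain P i j (take (rk z i j).+1 c) by apply: subseq_chain hc; exact: take_subseq.
have sz : size (take (rk z i j).+1 c) = (rk z i j).+1 by rewrite size_takel.
have j0 : 0 < j by have := chain_leq hc'; rewrite sz; lia.
have [A [B [ABc cA cB Ai Bj]]] := odot_of_chain iN jN hc'.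
have /chainP[_ hP] := hc'.
have oP x : x \in odot A B -> P (ord_pos x).
  by move=> xo; have [] := hP (ord_pos x); rewrite // -ABc; apply/mapP; exists x.
have gen : ideal_gen (@Jss_gen K n z) (uss K A B).
  apply: ideal_gen_mem; exists i, j, A, B; split=> //.
  by rewrite cA cB sz rk_cornerE.
move: gen; rewrite ussE; last first.
  by move=> x /oP; rewrite /P -val_eqE => /orP[]/monomial_pos_lower /=; lia.
move=> gen; have [|h ->] := @dvd_monomial K n (uss_support A B) m; last exact: ideal_genM.
move=> p Sp; have : monomial_pos m (ord_pos (val p)).
  have pl := valP p; case/orP: Sp => /oP /orP[] // /monomial_pos_lower /andP[/= pl' _].
    by move: (ltn_trans pl pl'); rewrite ltnn.
  by move: (ltn_trans pl pl'); rewrite ltnn.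
by case/existsP => q /andP[/eqP qp]; have -> : q = p
  by apply: val_inj; case: (val q) (val p) qp => a b [a' b'] [/val_inj -> /val_inj ->].
Qed.

Lemma FP_of_monomial m : ~ Jss z ('X_[m] : skew_ring K n) ->
  exists2 D, FP z D & forall x, x \in D -> ~~ monomial_pos m x.
Proof.
move=> nJ; have [M [Mev nM zP ztail]] := FPF_image_fpf hz.
pose C x := monomial_pos m x || monomial_pos m (tr x).
(* Off-diagonal positions outside [M] x [M] belong to [P] from the start, so only finitely many are
   left to un-read. Chains in corners up to M never meet them. *)
pose P : pred pos := fun x => (x.1 != x.2) && [|| C x, M <= x.1 | M <= x.2].
have Ctr x : C (tr x) = C x by rewrite /C trK orbC.
have Ptr x : P (tr x) = P x by rewrite /P Ctr eq_sym /= (orbC (M <= x.2)).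
have Cn x : C x -> (x.1 < n) && (x.2 < n).
  by case/orP => /monomial_pos_lower /=; lia.
have zb : bounded M z P.
  move=> i j c iM jM /chainP[h1 h2].
  (* Variables exist only inside [n] x [n], so the corner can be clipped to n, where generators of
     the ideal are available. *)
  have hc : chain C (minn i n) (minn j n) c.
    apply/chainP; split=> // x /h2[/andP[_ /or3P[Cx|h|h]] xi xj].
    - by have /andP[x1 x2] := Cn _ Cx; split; rewrite // leq_min ?xi ?xj ?x1 ?x2.
    - by move: (leq_trans (leq_trans xi iM) h); rewrite ltnn.
    - by move: (leq_trans (leq_trans xj jM) h); rewrite ltnn.
  case: (leqP (size c) (rk z (minn i n) (minn j n))) => [h|/(Jss_of_chain _ _ hc) J].
    apply: leq_trans h (leq_trans (leq_rkr _ _ (geq_minl _ _)) (leq_rkl _ _ (geq_minl _ _))).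
  by case: nJ; apply: J; exact: geq_minr.
pose l := sort reading_le [seq x <- [seq (a, b) | a <- iota 0 M, b <- iota 0 M] | x.2 < x.1].
have lr : pairwise read_lt l.
  apply: pairwise_sort_read; apply: filter_uniq; apply: allpairs_uniq; rewrite ?iota_uniq //.
  by move=> [? ?] [? ?] _ _.
have ll : all (fun x => x.2 < x.1) l by rewrite all_sort filter_all.
have lP (x : pos) : x.2 < x.1 -> (x \in l) || P x.
  move=> xl; case: (ltnP x.1 M) => xM; last first.
    by rewrite /P xM !orbT andbT; apply/orP; right; lia.
  apply/orP; left; rewrite mem_sort mem_filter xl /=.
  apply/allpairsP; exists x; rewrite !mem_iota !add0n.
  by split; [exact: xM | exact: ltn_trans xl xM | exact: surjective_pairing].
have Pd x : P x -> x.1 != x.2 by case/andP.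
have [d [dl dP dM zE zinv]] := extract_word Mev zP Ptr Pd lr ll lP zb.
have dr := subseq_pairwise dl lr.
have dlow : all (fun x => x.2 < x.1) d by apply/allP => x /(mem_subseq dl)/(allP ll).
have [D zD Dd] := FP_of_word Mev zP ztail dr dlow dM zE zinv.
exists D => // x /Dd xd; have := allP dP x xd; apply: contra => xm.
have := monomial_pos_lower xm; rewrite /= /P /C xm /=; lia.
Qed.

End Main.
Theorem theorem4p15 (K : closedFieldType) (n : nat) (z : nat -> nat)
    (hn : (0 < n)%N) (hz : FPF_image n z) (f : skew_ring K n) :
  Jss z f <->
  (forall D : {fset nat * nat}, FP z D -> variable_ideal D f).
Proof.
split=> [[k [a [g [hg ->]]]] D zD|hf].
  apply: ideal_gen_sum => l _; apply: ideal_genM.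
  by have [i [j [A [B [_ Ai Bj [cA cB] ->]]]]] := hg l; exact: (uss_mem_variable_ideal K zD Ai Bj cA cB).
have fE : f = (\sum_(m <- msupp (f : {mpoly K[_]})) (f : {mpoly K[_]})@_m *: 'X_[m])%R := mpolyE f.
rewrite fE; apply: ideal_gen_sum => m mf.
(* A monomial of [f] outside the ideal would avoid some [D], whereas membership of [f] in the
   variable ideal of [D] gives each of its monomials a variable from [D]. *)
rewrite -mul_mpolyC; apply: ideal_genM; apply: NNPP => nJ.
have [D zD Dm] := FP_of_monomial hz nJ.
have [p pD pm] := variable_ideal_msupp (hf D zD) mf.
by case/negP: (Dm _ pD); apply/existsP; exists p; rewrite eqxx.
Qed.
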